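(* Let $M$ be a closed subspace of $\mathcal H^2(\mathbb T)$ and let $p,q\in M$ be unit vectors such that $$M\cap p^\perp=S(M\cap q^\perp).$$ (i) Then $q=\theta p$ for some inner function $\theta$. (ii) Assume in addition that for every $f\in\operatorname{Ran}H_\theta\cap\mathcal H^\infty(\mathbb T)$ the following implication holds: if $pf\in M$ and $f\perp\mathbbm 1$, then $pf\perp p$. Then $p$ is an isometric multiplier on $\operatorname{Ran}H_\theta$ and $M=p\operatorname{Ran}H_\theta$.
   Context: $\mathcal H^2=\mathcal H^2(\mathbb T)$, $S$ the shift $Sf=zf$, $\mathbbm 1$ the constant function $1$, $x^\perp$ the orthogonal complement of a vector $x$. For inner $\theta$, $\operatorname{Ran}H_\theta=\mathcal H^2\ominus z\theta\mathcal H^2=\{f\in\mathcal H^2:\theta\overline f\in\mathcal H^2\}$. A holomorphic $p$ on $\mathbb D$ is an isometric multiplier on a closed subspace $F\subset\mathcal H^2$ if $pf\in\mathcal H^2$ and $\|pf\|=\|f\|$ for all $f\in F$; $pF=\{pf:f\in F\}$. *)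

(* Defs.v *)
From Stdlib Require Import Reals Lra.
Open Scope R_scope.

Definition C : Type := (R * R)%type.
Definition C0 : C := (0, 0).
Definition C1 : C := (1, 0).
Definition Cadd (z w : C) : C := (fst z + fst w, snd z + snd w).
Definition Copp (z : C) : C := (- fst z, - snd z).
Definition Csub (z w : C) : C := Cadd z (Copp w).
Definition Cmul (z w : C) : C :=
  (fst z * fst w - snd z * snd w, fst z * snd w + snd z * fst w).
Definition Cconj (z : C) : C := (fst z, - snd z).
Definition Cnorm2 (z : C) : R := fst z * fst z + snd z * snd z.
Fixpoint Cpow (z : C) (n : nat) : C :=
  match n with O => C1 | S m => Cmul z (Cpow z m) end.

Definition Cseries_sum (u : nat -> C) (s : C) : Prop :=
  infinite_sum (fun n => fst (u n)) (fst s) /\ infinite_sum (fun n => snd (u n)) (snd s).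

Fixpoint Csum (u : nat -> C) (n : nat) : C :=
  match n with O => u O | S m => Cadd (Csum u m) (u (S m)) end.

(* Elements of H^2 (and holomorphic functions on D) are represented by their
   Taylor coefficient sequences f(z) = sum_n f_n z^n. *)
Definition fn := nat -> C.

Definition has_norm2 (f : fn) (l : R) : Prop := infinite_sum (fun n => Cnorm2 (f n)) l.
Definition inH2 (f : fn) : Prop := exists l, has_norm2 f l.
Definition unit_vec (f : fn) : Prop := has_norm2 f 1.

Definition inner_prod (f g : fn) (s : C) : Prop := Cseries_sum (fun n => Cmul (f n) (Cconj (g n))) s.
Definition orth (f g : fn) : Prop := inner_prod f g C0.

Definition one : fn := fun n => match n with O => C1 | S _ => C0 end.

Definition shift (f : fn) : fn := fun n => match n with O => C0 | S m => f m end.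

(* Product of holomorphic functions = Cauchy product of Taylor coefficients. *)
Definition cauchy (a b : fn) : fn := fun n => Csum (fun k => Cmul (a k) (b (n - k)%nat)) n.

Record closed_subspace (M : fn -> Prop) : Prop := {
  cs_H2 : forall f, M f -> inH2 f;
  cs_zero : M (fun _ => C0);
  cs_add : forall f g, M f -> M g -> M (fun n => Cadd (f n) (g n));
  cs_scal : forall c f, M f -> M (fun n => Cmul c (f n));
  cs_closed : forall f, inH2 f ->
     (forall eps, 0 < eps -> exists g, M g /\
        exists l, has_norm2 (fun n => Csub (f n) (g n)) l /\ l < eps) -> M f
}.

Definition ps_eval (a : fn) (z : C) (w : C) : Prop :=
  Cseries_sum (fun n => Cmul (a n) (Cpow z n)) w.

Definition Hinf (a : fn) : Prop :=
  exists B, forall z, Cnorm2 z < 1 -> exists w, ps_eval a z w /\ Cnorm2 w <= B.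

Definition null_set (E : R -> Prop) : Prop :=
  forall eps, 0 < eps -> exists a b : nat -> R,
    (forall k, a k <= b k) /\
    (forall N, sum_f_R0 (fun k => b k - a k) N <= eps) /\
    (forall x, E x -> exists k, a k < x < b k).

Definition radial_limit (a : fn) (t : R) (L : C) : Prop :=
  forall eps, 0 < eps -> exists delta, 0 < delta /\
    forall r, 0 <= r -> 1 - delta < r -> r < 1 ->
      exists w, ps_eval a (r * cos t, r * sin t) w /\ Cnorm2 (Csub w L) < eps.

Definition inner (th : fn) : Prop :=
  Hinf th /\ exists E, null_set E /\
    forall t, 0 <= t <= 2 * PI -> ~ E t ->
      exists L, radial_limit th t L /\ Cnorm2 L = 1.

(* Ran H_theta = H^2 \ominus z theta H^2. *)
Definition RanH (th : fn) (f : fn) : Prop :=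
  inH2 f /\ forall g, inH2 g -> orth f (shift (cauchy th g)).

Definition isometric_multiplier (p : fn) (F : fn -> Prop) : Prop :=
  forall f, F f -> inH2 (cauchy p f) /\ forall l, has_norm2 f l -> has_norm2 (cauchy p f) l.

(* Main.v *)
(** Write [f = <f,p> p + z g] with [g] in [M] orthogonal to [q]. Iterating this isometric
    decomposition, with an input [u] fed into the direction of [q], gives an energy preserving
    linear system on [M] with transfer function [z theta], where [q = theta p]; hence
    multiplication by [theta] is contractive on H^2, and it preserves the norm of [p]. The vectors
    whose norm it preserves form a closed shift invariant subspace [K]; a wandering vector of [K]
    is a multiple of an inner function, which forces [theta] to have norm [1], so [1] is in [K],
    [K] is all of H^2 and [theta] is isometric. Radial limits of modulus [1] then come from a
    maximal inequality for dyadic blocks of [theta] and from Chebyshev's inequality for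
    [1 - |theta|^2]. Writing [f = p h] for [f] in [M], the energy balance for arbitrary inputs
    shows that [h] is in [Ran H_theta]; running the system backwards on polynomials shows that
    [p] maps [Ran H_theta] isometrically into [M]. *)

From Coquelicot Require Import Rcomplements Rbar Lim_seq Series Hierarchy Continuity Derive RInt RInt_analysis AutoDerive.
From Stdlib Require Import Arith Reals Lra Lia FunctionalExtensionality ClassicalEpsilon List.
Require Import Defs.
Open Scope R_scope.

(** Elements of H^2 are bare coefficient sequences, so no boundary function is at hand: that q/p is
    bounded, that it is isometric and that it has boundary values must all come from norm
    identities. A product of two H^2 functions may leave H^2, so products with [p] and [q] are
    formal Cauchy products. Formal power series have no zero divisors; cancelling [p] therefore
    replaces linearity arguments for the system and shows that theta is the only series with q =
    theta p. The truncations of theta are chosen with squared tails at most 8^-k = 4^-k 2^-k: the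
    maximal inequality at level 4^-k for the squared modulus then bounds the k-th block by 2^-k off
    intervals of total length O(2^-k), and both bounds are summable. Means of polynomials over the
    circle are increments of explicit primitives over [-pi, 3 pi], two full periods, which contains
    [t - pi, t + pi] for every t in [0, 2 pi]. *)

(** * Complex arithmetic *)

Lemma C_ext (z w : C) : fst z = fst w -> snd z = snd w -> z = w.
Proof. destruct z, w; simpl; intros -> ->; reflexivity. Qed.

Ltac C_solve := intros; apply C_ext;
  unfold Csub, Cadd, Copp, Cmul, Cconj, C0, C1, Cnorm2 in *; simpl; try ring.

Lemma C_ring : ring_theory C0 C1 Cadd Cmul Csub Copp (@eq C).
Proof. constructor; C_solve. Qed.

Add Ring C_ring_inst : C_ring.

Lemma Cconj_invol (z : C) : Cconj (Cconj z) = z.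
Proof. C_solve. Qed.

Lemma Cconj_mul (z w : C) : Cconj (Cmul z w) = Cmul (Cconj z) (Cconj w).
Proof. C_solve. Qed.

Lemma Cconj_add (z w : C) : Cconj (Cadd z w) = Cadd (Cconj z) (Cconj w).
Proof. C_solve. Qed.

Lemma Cnorm2_ge0 (z : C) : 0 <= Cnorm2 z.
Proof. unfold Cnorm2; nra. Qed.

Lemma Cnorm2_mul (z w : C) : Cnorm2 (Cmul z w) = Cnorm2 z * Cnorm2 w.
Proof. unfold Cnorm2, Cmul; simpl; ring. Qed.

Lemma Cnorm2_conj (z : C) : Cnorm2 (Cconj z) = Cnorm2 z.
Proof. unfold Cnorm2, Cconj; simpl; ring. Qed.

Lemma Cnorm2_eq0 (z : C) : Cnorm2 z = 0 -> z = C0.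
Proof.
  unfold Cnorm2; intros H.
  destruct (Rplus_sqr_eq_0 (fst z) (snd z) H); now apply C_ext.
Qed.

Lemma Cmul_integral (z w : C) : Cmul z w = C0 -> z <> C0 -> w = C0.
Proof.
  intros H Hz; apply Cnorm2_eq0.
  assert (E : Cnorm2 z * Cnorm2 w = 0)
    by (rewrite <- Cnorm2_mul, H; unfold Cnorm2; simpl; ring).
  apply Rmult_integral in E; destruct E as [E|E]; auto.
  apply Cnorm2_eq0 in E; contradiction.
Qed.

(** * Formal power series *)

Definition fadd (f g : fn) : fn := fun n => Cadd (f n) (g n).
Definition fsub (f g : fn) : fn := fun n => Csub (f n) (g n).
Definition fscal (c : C) (f : fn) : fn := fun n => Cmul c (f n).
Definition fzero : fn := fun _ => C0.
Definition tl (f : fn) : fn := fun n => f (S n).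

Ltac fn_solve := intros; apply functional_extensionality;
  let n := fresh "n" in intros n; unfold fadd, fsub, fscal, fzero;
  first [ring | destruct n as [|n]; unfold tl, shift; simpl; ring].

Lemma hd_tl (f : fn) : f = fadd (fscal (f O) one) (shift (tl f)).
Proof. fn_solve. Qed.

Lemma Csum_ext (u v : nat -> C) n :
  (forall k, (k <= n)%nat -> u k = v k) -> Csum u n = Csum v n.
Proof.
  induction n as [|n IH]; simpl; intros H; [apply H; lia|].
  rewrite IH by (intros; apply H; lia). now rewrite (H (S n)) by lia.
Qed.

Lemma Csum_first (u : nat -> C) n : Csum u (S n) = Cadd (u O) (Csum (fun k => u (S k)) n).
Proof.
  induction n as [|n IH]; [reflexivity|].
  change (Csum u (S (S n))) with (Cadd (Csum u (S n)) (u (S (S n)))).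
  rewrite IH; simpl; ring.
Qed.

Lemma cauchy_O (a b : fn) : cauchy a b O = Cmul (a O) (b O).
Proof. reflexivity. Qed.

Lemma cauchy_S (a b : fn) n :
  cauchy a b (S n) = Cadd (Cmul (a O) (b (S n))) (cauchy (tl a) b n).
Proof. unfold cauchy; rewrite Csum_first; reflexivity. Qed.

Lemma cauchy_S_r (a b : fn) n :
  cauchy a b (S n) = Cadd (cauchy a (tl b) n) (Cmul (a (S n)) (b O)).
Proof.
  unfold cauchy; cbn [Csum]; rewrite Nat.sub_diag; f_equal.
  apply Csum_ext; intros k Hk; unfold tl; now rewrite Nat.sub_succ_l by lia.
Qed.

Lemma cauchy_comm (a b : fn) : cauchy a b = cauchy b a.
Proof.
  apply functional_extensionality; intros n; revert a b.
  induction n as [|n IH]; intros a b; [rewrite !cauchy_O; ring|].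
  rewrite cauchy_S, cauchy_S_r, IH; ring.
Qed.

Lemma cauchy_add_l (a a' b : fn) : cauchy (fadd a a') b = fadd (cauchy a b) (cauchy a' b).
Proof.
  apply functional_extensionality; intros n; revert a a'.
  induction n as [|n IH]; intros a a'; unfold fadd.
  - rewrite !cauchy_O; ring.
  - rewrite !cauchy_S; change (tl (fun n => Cadd (a n) (a' n))) with (fadd (tl a) (tl a')).
    rewrite IH; unfold fadd; ring.
Qed.

Lemma cauchy_scal_l (c : C) (a b : fn) : cauchy (fscal c a) b = fscal c (cauchy a b).
Proof.
  apply functional_extensionality; intros n; revert a.
  induction n as [|n IH]; intros a; unfold fscal.
  - rewrite !cauchy_O; ring.
  - rewrite !cauchy_S; change (tl (fun n => Cmul c (a n))) with (fscal c (tl a)).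
    rewrite IH; unfold fscal; ring.
Qed.

Lemma cauchy_shift_l (a b : fn) : cauchy (shift a) b = shift (cauchy a b).
Proof.
  apply functional_extensionality; intros [|n].
  - rewrite cauchy_O; simpl; ring.
  - rewrite cauchy_S; simpl; change (tl (shift a)) with a; ring.
Qed.

Lemma fsub_E (f g : fn) : fsub f g = fadd f (fscal (Copp C1) g).
Proof. fn_solve. Qed.

Lemma cauchy_sub_l (a a' b : fn) : cauchy (fsub a a') b = fsub (cauchy a b) (cauchy a' b).
Proof. now rewrite !fsub_E, cauchy_add_l, cauchy_scal_l. Qed.

Lemma cauchy_zero_l (b : fn) : cauchy fzero b = fzero.
Proof.
  replace fzero with (fscal C0 fzero) by fn_solve.
  rewrite cauchy_scal_l; fn_solve.
Qed.

Lemma cauchy_one_l (b : fn) : cauchy one b = b.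
Proof.
  apply functional_extensionality; intros [|n].
  - rewrite cauchy_O; simpl; ring.
  - rewrite cauchy_S; simpl; change (tl one) with fzero; rewrite cauchy_zero_l.
    unfold fzero; ring.
Qed.

Lemma cauchy_add_r (a b b' : fn) : cauchy a (fadd b b') = fadd (cauchy a b) (cauchy a b').
Proof. rewrite !(cauchy_comm a); apply cauchy_add_l. Qed.

Lemma cauchy_sub_r (a b b' : fn) : cauchy a (fsub b b') = fsub (cauchy a b) (cauchy a b').
Proof. rewrite !(cauchy_comm a); apply cauchy_sub_l. Qed.

Lemma cauchy_scal_r (c : C) (a b : fn) : cauchy a (fscal c b) = fscal c (cauchy a b).
Proof. rewrite !(cauchy_comm a); apply cauchy_scal_l. Qed.

Lemma cauchy_shift_r (a b : fn) : cauchy a (shift b) = shift (cauchy a b).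
Proof. rewrite !(cauchy_comm a); apply cauchy_shift_l. Qed.

Lemma cauchy_zero_r (a : fn) : cauchy a fzero = fzero.
Proof. rewrite cauchy_comm; apply cauchy_zero_l. Qed.

Lemma cauchy_one_r (a : fn) : cauchy a one = a.
Proof. rewrite cauchy_comm; apply cauchy_one_l. Qed.

Lemma cauchy_assoc (a b c : fn) : cauchy (cauchy a b) c = cauchy a (cauchy b c).
Proof.
  apply functional_extensionality; intros n; revert a.
  induction n as [|n IH]; intros a; [rewrite !cauchy_O; ring|].
  rewrite (hd_tl a) at 1.
  rewrite cauchy_add_l, cauchy_scal_l, cauchy_one_l, cauchy_shift_l.
  rewrite cauchy_add_l, cauchy_scal_l, cauchy_shift_l.
  rewrite (cauchy_S a); unfold fadd, fscal; simpl; rewrite IH; reflexivity.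
Qed.

Lemma cauchy_local (a b b' : fn) n :
  (forall k, (k <= n)%nat -> b k = b' k) -> cauchy a b n = cauchy a b' n.
Proof.
  intros H; apply Csum_ext; intros k Hk; rewrite H by lia; reflexivity.
Qed.

Lemma shift_inj (f g : fn) : shift f = shift g -> f = g.
Proof.
  intros H; apply functional_extensionality; intros n.
  exact (f_equal (fun h : fn => h (S n)) H).
Qed.

Lemma shift_fzero : shift fzero = fzero.
Proof. fn_solve. Qed.

Lemma cauchy_domain_0 (a d : fn) : a O <> C0 -> cauchy a d = fzero -> d = fzero.
Proof.
  intros Ha H; apply functional_extensionality; intros n; revert d H.
  induction n as [|n IH]; intros d H;
  assert (H0 : d O = C0)
    by (apply (Cmul_integral (a O)); auto; exact (f_equal (fun h : fn => h O) H)).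
  - exact H0.
  - apply (IH (tl d)). apply shift_inj. rewrite shift_fzero, <- H, <- cauchy_shift_r.
    f_equal. rewrite (hd_tl d) at 2. rewrite H0. fn_solve.
Qed.

(** Splits off the order of vanishing at 0. This reduces the absence of zero divisors to a factor
    with nonzero constant term, and later lets a wandering vector be found. *)
Lemma factor_shift (a : fn) m :
  a m <> C0 -> exists j a', a = Nat.iter j shift a' /\ a' O <> C0.
Proof.
  revert a; induction m as [|m IH]; intros a H.
  - exists O, a; auto.
  - destruct (classic (a O = C0)) as [E|E].
    + destruct (IH (tl a) H) as (j & a' & E1 & E2).
      exists (S j), a'; split; auto. simpl; rewrite <- E1.
      rewrite (hd_tl a) at 1; rewrite E; fn_solve.
    + exists O, a; auto.
Qed.

Lemma cauchy_domain (a d : fn) : a <> fzero -> cauchy a d = fzero -> d = fzero.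
Proof.
  intros Ha H.
  assert (Hm : exists m, a m <> C0).
  { apply not_all_ex_not; intros E; apply Ha, functional_extensionality; exact E. }
  destruct Hm as [m Hm]. destruct (factor_shift a m Hm) as (j & a' & E & H0).
  subst a; clear Ha Hm. apply (cauchy_domain_0 a'); auto.
  induction j as [|j IH]; auto. apply IH; simpl in H.
  rewrite cauchy_shift_l in H; apply shift_inj; rewrite H; symmetry; apply shift_fzero.
Qed.

Lemma cauchy_cancel (a b c : fn) : a <> fzero -> cauchy a b = cauchy a c -> b = c.
Proof.
  intros Ha H. assert (E : fsub b c = fzero).
  { apply (cauchy_domain a); auto. rewrite cauchy_sub_r, H; fn_solve. }
  apply functional_extensionality; intros n.
  pose proof (f_equal (fun h : fn => h n) E) as En; unfold fsub, fzero in En.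
  replace (b n) with (Cadd (Csub (b n) (c n)) (c n)) by ring. rewrite En; ring.
Qed.

(** * The Hilbert space of square summable coefficient sequences *)

Definition N2 (f : fn) : R := Series (fun n => Cnorm2 (f n)).

Definition ip (f g : fn) : C :=
  (Series (fun n => fst (Cmul (f n) (Cconj (g n)))),
   Series (fun n => snd (Cmul (f n) (Cconj (g n))))).

Lemma ex_series_dominated (a b : nat -> R) :
  ex_series b -> (forall n, Rabs (a n) <= b n) -> ex_series a.
Proof. intros Hb H; exact (@ex_series_le R_AbsRing R_CompleteNormedModule a b H Hb). Qed.

Lemma series_nonneg_bounded (a : nat -> R) (B : R) :
  (forall n, 0 <= a n) -> (forall n, sum_f_R0 a n <= B) -> ex_series a /\ Series a <= B.
Proof.
  intros H0 HB.
  assert (E : ex_finite_lim_seq (sum_n a)).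
  { apply ex_finite_lim_seq_incr with B.
    - intros n; rewrite sum_Sn; unfold plus; simpl; specialize (H0 (S n)); lra.
    - intros n; rewrite sum_n_Reals; apply HB. }
  destruct E as [l Hl]. assert (Hs : is_series a l) by exact Hl.
  split; [exists l; exact Hs|]. rewrite (is_series_unique _ _ Hs).
  apply (is_lim_seq_le (sum_n a) (fun _ => B) l B); auto.
  - intros n; rewrite sum_n_Reals; apply HB.
  - apply is_lim_seq_const.
Qed.

Lemma partial_le_series (a : nat -> R) n :
  (forall n, 0 <= a n) -> ex_series a -> sum_f_R0 a n <= Series a.
Proof.
  intros H0 H. apply Series_correct in H.
  apply (is_lim_seq_incr_compare (sum_n a) (Series a)) with (n := n) in H.
  - now rewrite sum_n_Reals in H.
  - intros k; rewrite sum_Sn; unfold plus; simpl; specialize (H0 (S k)); lra.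
Qed.

Lemma inH2_iff (f : fn) : inH2 f <-> ex_series (fun n => Cnorm2 (f n)).
Proof.
  split; intros [l H]; exists l; apply is_series_Reals; exact H.
Qed.

Lemma has_norm2_N2 (f : fn) l : has_norm2 f l -> N2 f = l.
Proof. intros H; apply is_series_unique, is_series_Reals, H. Qed.

Lemma N2_has_norm2 (f : fn) : inH2 f -> has_norm2 f (N2 f).
Proof.
  intros H; apply is_series_Reals, Series_correct, inH2_iff, H.
Qed.

Lemma inH2_bounded (f : fn) B :
  (forall n, sum_f_R0 (fun k => Cnorm2 (f k)) n <= B) -> inH2 f /\ N2 f <= B.
Proof.
  intros H; rewrite inH2_iff. apply series_nonneg_bounded; auto. intros; apply Cnorm2_ge0.
Qed.

Lemma partial_le_N2 (f : fn) n : inH2 f -> sum_f_R0 (fun k => Cnorm2 (f k)) n <= N2 f.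
Proof.
  intros H; apply partial_le_series; [intros; apply Cnorm2_ge0|now apply inH2_iff].
Qed.

Lemma N2_ge0 (f : fn) : inH2 f -> 0 <= N2 f.
Proof.
  intros H; eapply Rle_trans; [|apply (partial_le_N2 f O H)]; apply Cnorm2_ge0.
Qed.

Lemma coef_le_N2 (f : fn) n : inH2 f -> Cnorm2 (f n) <= N2 f.
Proof.
  intros H; eapply Rle_trans; [|apply (partial_le_N2 f n H)].
  destruct n; simpl; [lra|].
  assert (0 <= sum_f_R0 (fun k => Cnorm2 (f k)) n); [|lra].
  apply cond_pos_sum; intros; apply Cnorm2_ge0.
Qed.

Lemma N2_eq0 (f : fn) : inH2 f -> N2 f = 0 -> f = fzero.
Proof.
  intros H E; apply functional_extensionality; intros n; apply Cnorm2_eq0.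
  pose proof (coef_le_N2 f n H); pose proof (Cnorm2_ge0 (f n)); lra.
Qed.

Lemma ip_ex (f g : fn) : inH2 f -> inH2 g ->
  ex_series (fun n => fst (Cmul (f n) (Cconj (g n)))) /\
  ex_series (fun n => snd (Cmul (f n) (Cconj (g n)))).
Proof.
  intros Hf Hg; rewrite inH2_iff in Hf, Hg.
  assert (H : ex_series (fun n => Cnorm2 (f n) + Cnorm2 (g n)))
    by exact (ex_series_plus _ _ Hf Hg).
  split; apply (ex_series_dominated _ _ H); intros n; unfold Cnorm2;
  destruct (f n) as [a b], (g n) as [c d]; simpl;
  pose proof (pow2_ge_0 (a + c)); pose proof (pow2_ge_0 (b + d)); pose proof (pow2_ge_0 (a - c));
  pose proof (pow2_ge_0 (b - d)); pose proof (pow2_ge_0 (a + d)); pose proof (pow2_ge_0 (b + c));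
  pose proof (pow2_ge_0 (a - d)); pose proof (pow2_ge_0 (b - c));
  pose proof (pow2_ge_0 a); pose proof (pow2_ge_0 b); pose proof (pow2_ge_0 c);
  pose proof (pow2_ge_0 d); apply Rabs_le; split; lra.
Qed.

Lemma ip_inner (f g : fn) : inH2 f -> inH2 g -> inner_prod f g (ip f g).
Proof.
  intros Hf Hg; destruct (ip_ex f g Hf Hg) as [H1 H2].
  split; apply is_series_Reals; apply Series_correct; assumption.
Qed.

Lemma inner_prod_ip (f g : fn) s : inner_prod f g s -> ip f g = s.
Proof.
  intros [H1 H2]; apply C_ext; simpl; apply is_series_unique, is_series_Reals; assumption.
Qed.

Lemma orth_iff (f g : fn) : inH2 f -> inH2 g -> (orth f g <-> ip f g = C0).
Proof.
  intros Hf Hg; split; [apply inner_prod_ip|].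
  intros E; unfold orth; rewrite <- E; now apply ip_inner.
Qed.

Lemma inH2_fadd (f g : fn) : inH2 f -> inH2 g -> inH2 (fadd f g).
Proof.
  intros Hf Hg; rewrite inH2_iff in *.
  assert (H : ex_series (fun n => 2 * (Cnorm2 (f n) + Cnorm2 (g n)))).
  { apply (ex_series_scal_l 2 (fun n => Cnorm2 (f n) + Cnorm2 (g n))).
    exact (ex_series_plus _ _ Hf Hg). }
  apply (ex_series_dominated _ _ H); intros n.
  rewrite Rabs_pos_eq by apply Cnorm2_ge0.
  unfold fadd, Cadd, Cnorm2; destruct (f n) as [a b], (g n) as [c d]; simpl;
  pose proof (pow2_ge_0 (a - c)); pose proof (pow2_ge_0 (b - d)); lra.
Qed.

Lemma inH2_fscal c (f : fn) : inH2 f -> inH2 (fscal c f).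
Proof.
  intros Hf; rewrite inH2_iff in *.
  apply ex_series_ext with (fun n => Cnorm2 c * Cnorm2 (f n)).
  - intros n; unfold fscal; now rewrite Cnorm2_mul.
  - apply (ex_series_scal_l (Cnorm2 c) (fun n => Cnorm2 (f n))), Hf.
Qed.

Lemma inH2_fsub (f g : fn) : inH2 f -> inH2 g -> inH2 (fsub f g).
Proof. intros; rewrite fsub_E; now apply inH2_fadd; [|apply inH2_fscal]. Qed.

Lemma inH2_shift (f : fn) : inH2 f -> inH2 (shift f).
Proof.
  rewrite !inH2_iff; intros H; apply ex_series_incr_1; exact H.
Qed.

Lemma inH2_tl (f : fn) : inH2 f -> inH2 (tl f).
Proof.
  rewrite !inH2_iff; intros H; apply (ex_series_incr_1 (fun n => Cnorm2 (f n))); exact H.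
Qed.

Lemma has_norm2_finite (f : fn) n : (forall k, (n < k)%nat -> f k = C0) ->
  has_norm2 f (sum_f_R0 (fun k => Cnorm2 (f k)) n).
Proof.
  intros H eps He; exists n; intros m Hm. induction Hm as [|m Hm IH].
  - now rewrite Rdist_eq.
  - simpl; rewrite (H (S m)) by lia. unfold Cnorm2 at 2; simpl.
    replace (_ + (0 * 0 + 0 * 0)) with (sum_f_R0 (fun k => Cnorm2 (f k)) m) by ring. exact IH.
Qed.

Lemma inH2_finite (f : fn) n : (forall k, (n < k)%nat -> f k = C0) -> inH2 f.
Proof. intros H; eexists; apply has_norm2_finite with (1 := H). Qed.

Lemma inH2_fzero : inH2 fzero.
Proof. apply inH2_finite with O; reflexivity. Qed.

Lemma inH2_one : inH2 one.
Proof. apply inH2_finite with O; intros [|k] Hk; [lia|reflexivity]. Qed.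

Lemma N2_finite (f : fn) n : (forall k, (n < k)%nat -> f k = C0) ->
  N2 f = sum_f_R0 (fun k => Cnorm2 (f k)) n.
Proof. intros H; now apply has_norm2_N2, has_norm2_finite. Qed.

Lemma N2_one : N2 one = 1.
Proof.
  rewrite (N2_finite one O); [unfold Cnorm2; simpl; ring|].
  intros [|k] Hk; [lia|reflexivity].
Qed.

Lemma N2_fzero : N2 fzero = 0.
Proof. rewrite (N2_finite fzero O); [unfold Cnorm2; simpl; ring|reflexivity]. Qed.

Create HintDb h2.
Hint Resolve inH2_fadd inH2_fsub inH2_fscal inH2_shift inH2_tl inH2_fzero inH2_one : h2.

Lemma N2_shift (f : fn) : inH2 f -> N2 (shift f) = N2 f.
Proof.
  intros H; unfold N2; rewrite Series_incr_1.
  - unfold Cnorm2 at 1; simpl; ring_simplify; reflexivity.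
  - now apply inH2_iff, inH2_shift.
Qed.

Lemma N2_hd_tl (f : fn) : inH2 f -> N2 f = Cnorm2 (f O) + N2 (tl f).
Proof. intros H; apply inH2_iff in H; apply (Series_incr_1 _ H). Qed.

Lemma N2_fscal c (f : fn) : N2 (fscal c f) = Cnorm2 c * N2 f.
Proof.
  unfold N2; rewrite <- Series_scal_l; apply Series_ext; intros n; apply Cnorm2_mul.
Qed.

Lemma ip_self (f : fn) : ip f f = (N2 f, 0).
Proof.
  apply C_ext; simpl; [apply Series_ext; intros n; unfold Cnorm2; ring|].
  rewrite (Series_ext _ (fun n => 0 * 0)) by (intros; ring).
  rewrite Series_scal_l; ring.
Qed.

Lemma ip_add_l (f g h : fn) : inH2 f -> inH2 g -> inH2 h ->
  ip (fadd f g) h = Cadd (ip f h) (ip g h).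
Proof.
  intros Hf Hg Hh. destruct (ip_ex f h Hf Hh), (ip_ex g h Hg Hh).
  apply C_ext; cbn [ip fst snd Cadd]; rewrite <- Series_plus by assumption;
  apply Series_ext; intros n; unfold fadd, Cadd, Cmul, Cconj; simpl; ring.
Qed.

Lemma ip_scal_l c (f g : fn) : inH2 f -> inH2 g -> ip (fscal c f) g = Cmul c (ip f g).
Proof.
  intros Hf Hg; destruct (ip_ex f g Hf Hg) as [H1 H2].
  apply C_ext; cbn [ip fst snd Cmul]; rewrite <- !Series_scal_l.
  - rewrite <- Series_minus.
    + apply Series_ext; intros n; unfold fscal, Cmul, Cconj; simpl; ring.
    + exact (ex_series_scal_l (fst c) _ H1).
    + exact (ex_series_scal_l (snd c) _ H2).
  - rewrite <- Series_plus.
    + apply Series_ext; intros n; unfold fscal, Cmul, Cconj; simpl; ring.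
    + exact (ex_series_scal_l (fst c) _ H2).
    + exact (ex_series_scal_l (snd c) _ H1).
Qed.

Lemma ip_sym (f g : fn) : ip g f = Cconj (ip f g).
Proof.
  apply C_ext; cbn [ip fst snd Cconj].
  - apply Series_ext; intros n; unfold Cmul, Cconj; simpl; ring.
  - rewrite <- Series_opp; apply Series_ext; intros n; unfold Cmul, Cconj; simpl; ring.
Qed.

Lemma ip_add_r (f g h : fn) : inH2 f -> inH2 g -> inH2 h ->
  ip h (fadd f g) = Cadd (ip h f) (ip h g).
Proof.
  intros; rewrite ip_sym, ip_add_l, Cconj_add by assumption; now rewrite <- !ip_sym.
Qed.

Lemma ip_scal_r c (f g : fn) : inH2 f -> inH2 g -> ip g (fscal c f) = Cmul (Cconj c) (ip g f).
Proof.
  intros; rewrite ip_sym, ip_scal_l, Cconj_mul by assumption; now rewrite <- ip_sym.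
Qed.

Lemma ip_sub_l (f g h : fn) : inH2 f -> inH2 g -> inH2 h ->
  ip (fsub f g) h = Csub (ip f h) (ip g h).
Proof.
  intros; rewrite fsub_E, ip_add_l, ip_scal_l by auto with h2; ring.
Qed.

Lemma ip_shift (f g : fn) : inH2 f -> inH2 g -> ip (shift f) (shift g) = ip f g.
Proof.
  intros Hf Hg.
  destruct (ip_ex (shift f) (shift g)) as [H1 H2]; auto with h2.
  unfold ip; rewrite (Series_incr_1 _ H1), (Series_incr_1 _ H2); simpl.
  apply C_ext; simpl; ring_simplify; apply Series_ext; intros; ring.
Qed.

Lemma ip_shift_one (f : fn) : ip (shift f) one = C0.
Proof.
  apply inner_prod_ip. split; intros eps He; exists O; intros n _;
    rewrite (sum_eq _ (fun _ => 0)), sum_cte by (intros [|i] _; simpl; ring);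
    rewrite Rmult_0_l, Rdist_eq; auto.
Qed.

Lemma N2_fadd (f g : fn) : inH2 f -> inH2 g ->
  N2 (fadd f g) = N2 f + N2 g + 2 * fst (ip f g).
Proof.
  intros Hf Hg.
  pose proof (ip_self (fadd f g)) as E.
  rewrite ip_add_l, !ip_add_r, !ip_self, (ip_sym f g) in E by auto with h2.
  apply (f_equal fst) in E; cbn [Cadd fst snd Cconj] in E; lra.
Qed.

Lemma N2_fsub (f g : fn) : inH2 f -> inH2 g ->
  N2 (fsub f g) = N2 f + N2 g - 2 * fst (ip f g).
Proof.
  intros Hf Hg; rewrite fsub_E, N2_fadd, N2_fscal, ip_scal_r by auto with h2.
  unfold Cnorm2, Copp, Cconj, Cmul, C1; simpl; ring.
Qed.

Lemma N2_sub_sym (f g : fn) : N2 (fsub f g) = N2 (fsub g f).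
Proof.
  unfold N2; apply Series_ext; intros n; unfold fsub, Csub, Cadd, Copp, Cnorm2; simpl; ring.
Qed.

Lemma parallelogram (f g : fn) : inH2 f -> inH2 g ->
  N2 (fadd f g) + N2 (fsub f g) = 2 * N2 f + 2 * N2 g.
Proof. intros; rewrite N2_fadd, N2_fsub by assumption; ring. Qed.

Lemma N2_orth_add (f g : fn) : inH2 f -> inH2 g -> ip f g = C0 ->
  N2 (fadd f g) = N2 f + N2 g.
Proof. intros Hf Hg E; rewrite N2_fadd, E by assumption; simpl; ring. Qed.

(** The quadratic polynomial N2 (f + t g) in the real variable t is nonnegative; evaluate it at its
    minimum. *)
Lemma cauchy_schwarz_re (f g : fn) : inH2 f -> inH2 g -> fst (ip f g) * fst (ip f g) <= N2 f * N2 g.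
Proof.
  intros Hf Hg.
  assert (H : forall t, 0 <= N2 f + t * t * N2 g + 2 * t * fst (ip f g)).
  { intros t; replace (_ + _) with (N2 (fadd f (fscal (t, 0) g))); [apply N2_ge0; auto with h2|].
    rewrite N2_fadd, N2_fscal, ip_scal_r by auto with h2; unfold Cnorm2; simpl; ring. }
  pose proof (N2_ge0 g Hg) as G; pose proof (N2_ge0 f Hf) as F.
  destruct (Req_dec (N2 g) 0) as [E|E].
  - rewrite (N2_eq0 g Hg E). replace (ip f fzero) with C0; [simpl; rewrite N2_fzero; lra|].
    replace fzero with (fscal C0 fzero) by fn_solve. rewrite ip_scal_r; auto with h2. C_solve.
  - specialize (H (- fst (ip f g) / N2 g)).
    apply Rmult_le_compat_l with (1 := G) in H. rewrite Rmult_0_r in H.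
    replace (N2 g * _) with (N2 f * N2 g - fst (ip f g) * fst (ip f g)) in H by (field; auto). lra.
Qed.

Lemma cauchy_schwarz (f g : fn) : inH2 f -> inH2 g -> Cnorm2 (ip f g) <= N2 f * N2 g.
Proof.
  (* Scaling g by <f,g> turns the inner product into the real number |<f,g>|^2. *)
  intros Hf Hg. pose proof (cauchy_schwarz_re f (fscal (ip f g) g)) as H.
  rewrite ip_scal_r, N2_fscal in H by auto with h2.
  assert (E : fst (Cmul (Cconj (ip f g)) (ip f g)) = Cnorm2 (ip f g)) by (unfold Cnorm2; simpl; ring).
  rewrite E in H; specialize (H Hf (inH2_fscal _ _ Hg)).
  pose proof (Cnorm2_ge0 (ip f g)). pose proof (N2_ge0 f Hf); pose proof (N2_ge0 g Hg).
  destruct (Req_dec (Cnorm2 (ip f g)) 0) as [Z|Z]; [rewrite Z; nra|].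
  apply Rmult_le_reg_l with (Cnorm2 (ip f g)); nra.
Qed.

(** * Truncation, lower semicontinuity and projection *)

Definition trunc (N : nat) (f : fn) : fn := fun k => if (k <? N)%nat then f k else C0.

Lemma trunc_lt N f k : (k < N)%nat -> trunc N f k = f k.
Proof. intros H; unfold trunc; now rewrite (proj2 (Nat.ltb_lt _ _) H). Qed.

Lemma trunc_ge N f k : (N <= k)%nat -> trunc N f k = C0.
Proof. intros H; unfold trunc; now rewrite (proj2 (Nat.ltb_ge _ _) H). Qed.

Lemma inH2_trunc N f : inH2 (trunc N f).
Proof. apply inH2_finite with N; intros; apply trunc_ge; lia. Qed.
Hint Resolve inH2_trunc : h2.

Lemma N2_trunc n f : N2 (trunc (S n) f) = sum_f_R0 (fun k => Cnorm2 (f k)) n.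
Proof.
  rewrite (N2_finite _ n) by (intros; apply trunc_ge; lia).
  apply sum_eq; intros; now rewrite trunc_lt by lia.
Qed.

Lemma N2_trunc_le N f : inH2 f -> N2 (trunc N f) <= N2 f.
Proof.
  intros H; destruct N as [|n].
  - replace (trunc 0 f) with fzero by reflexivity. rewrite N2_fzero; now apply N2_ge0.
  - rewrite N2_trunc; now apply partial_le_N2.
Qed.

Lemma N2_tail N f : inH2 f -> N2 (fsub f (trunc N f)) = N2 f - N2 (trunc N f).
Proof.
  intros H; rewrite N2_fsub by auto with h2.
  assert (E : fst (ip f (trunc N f)) = N2 (trunc N f)); [|rewrite E; ring].
  unfold ip, N2; simpl; apply Series_ext; intros n; unfold trunc.
  destruct (n <? N)%nat; unfold Cnorm2; simpl; ring.
Qed.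

Lemma N2_tail_small f eps : inH2 f -> 0 < eps ->
  exists N, forall n, (N <= n)%nat -> N2 (fsub f (trunc n f)) < eps.
Proof.
  intros H He. destruct (N2_has_norm2 f H eps He) as [N HN]. exists (S N).
  intros [|n] Hn; [lia|]. specialize (HN n ltac:(lia)).
  rewrite N2_tail, N2_trunc by assumption. unfold Rdist in HN.
  apply Rabs_def2 in HN; lra.
Qed.

(** Coefficientwise convergence is the mode of convergence that any formal Cauchy product respects,
    even when multiplication is unbounded on H^2. *)
Definition coef_lim (g : nat -> fn) (f : fn) : Prop :=
  forall k eps, 0 < eps -> exists N, forall n, (N <= n)%nat -> Cnorm2 (Csub (g n k) (f k)) < eps.

(** Young's inequality with a free weight: it plays the role of the triangle inequality while only
    squared norms are used. *)
Lemma Cnorm2_add_le z w t : 0 < t ->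
  Cnorm2 (Cadd z w) <= (1 + t) * Cnorm2 z + (1 + / t) * Cnorm2 w.
Proof.
  intros Ht. assert (H : 0 <= (t * fst z - fst w)^2 / t + (t * snd z - snd w)^2 / t).
  { apply Rplus_le_le_0_compat; apply Rmult_le_pos; try apply pow2_ge_0;
    left; now apply Rinv_0_lt_compat. }
  unfold Cnorm2, Cadd; simpl.
  replace ((t * fst z - fst w)^2 / t + (t * snd z - snd w)^2 / t) with
    ((1 + t) * (fst z * fst z + snd z * snd z) + (1 + / t) * (fst w * fst w + snd w * snd w)
     - ((fst z + fst w) * (fst z + fst w) + (snd z + snd w) * (snd z + snd w))) in H by (field; lra).
  lra.
Qed.

Lemma N2_add_le f g t : inH2 f -> inH2 g -> 0 < t ->
  N2 (fadd f g) <= (1 + t) * N2 f + (1 + / t) * N2 g.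
Proof.
  intros Hf Hg Ht. apply inH2_iff in Hf, Hg.
  unfold N2; rewrite <- !Series_scal_l, <- Series_plus
    by (apply (ex_series_scal_l _ (fun n => Cnorm2 _)); assumption).
  apply Series_le.
  - intros n; split; [apply Cnorm2_ge0|now apply Cnorm2_add_le].
  - apply (ex_series_plus (fun n => (1 + t) * Cnorm2 (f n)) (fun n => (1 + / t) * Cnorm2 (g n)));
      apply (ex_series_scal_l _ (fun n => Cnorm2 _)); assumption.
Qed.

Lemma sum_coef_lim g f n eps : coef_lim g f -> 0 < eps ->
  exists N, forall m, (N <= m)%nat ->
    sum_f_R0 (fun k => Cnorm2 (Csub (g m k) (f k))) n < eps.
Proof.
  intros H; revert eps; induction n as [|n IH]; intros eps He; [exact (H O eps He)|].
  destruct (IH (eps/2)) as [N1 H1]; [lra|]. destruct (H (S n) (eps/2)) as [N2' H2]; [lra|].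
  exists (max N1 N2'); intros m Hm; simpl.
  specialize (H1 m ltac:(lia)); specialize (H2 m ltac:(lia)); lra.
Qed.

(** Fatou's lemma for sequences: each partial sum of the norm of f involves finitely many
    coefficients, hence is nearly a partial sum for some [g m]. *)
Lemma N2_lsc g f B : coef_lim g f ->
  (exists N, forall n, (N <= n)%nat -> inH2 (g n) /\ N2 (g n) <= B) -> inH2 f /\ N2 f <= B.
Proof.
  intros H [N HN]. apply inH2_bounded; intros n.
  assert (HB : 0 <= B).
  { destruct (HN N (le_n N)) as [H1 H2]; pose proof (N2_ge0 _ H1); lra. }
  apply le_epsilon; intros eps He.
  (* With this weight t B is at most eps/2, and [d] below makes (1 + 1/t) d equal to eps/2. *)
  set (t := eps / (2 * (B + 1))).
  assert (Ht : 0 < t) by (apply Rdiv_lt_0_compat; lra).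
  assert (Hi : 0 < / t) by now apply Rinv_0_lt_compat.
  set (d := eps / 2 / (1 + / t)).
  assert (Hd : 0 < d) by (apply Rdiv_lt_0_compat; lra).
  destruct (sum_coef_lim g f n d H Hd) as [N' HN'].
  set (m := max N N'). destruct (HN m) as [G1 G2]; [lia|]. specialize (HN' m ltac:(lia)).
  apply Rle_trans with ((1 + t) * sum_f_R0 (fun k => Cnorm2 (g m k)) n
    + (1 + / t) * sum_f_R0 (fun k => Cnorm2 (Csub (g m k) (f k))) n).
  - rewrite !scal_sum, <- plus_sum. apply sum_Rle; intros k Hk.
    replace (f k) with (Cadd (g m k) (Csub (f k) (g m k))) at 1 by ring.
    replace (Cnorm2 (Csub (g m k) (f k))) with (Cnorm2 (Csub (f k) (g m k)))
      by (unfold Csub, Cadd, Copp, Cnorm2; simpl; ring).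
    rewrite (Rmult_comm (Cnorm2 _)), (Rmult_comm (Cnorm2 _) (1 + / t)). now apply Cnorm2_add_le.
  - pose proof (partial_le_N2 (g m) n G1) as P.
    assert (E1 : t * (2 * (B + 1)) = eps) by (unfold t; field; lra).
    assert (E2 : (1 + / t) * d = eps / 2) by (unfold d; field; split; lra).
    assert ((1 + / t) * sum_f_R0 (fun k => Cnorm2 (Csub (g m k) (f k))) n <= eps / 2).
    { rewrite <- E2; apply Rmult_le_compat_l; lra. }
    nra.
Qed.

Lemma coef_lim_norm g f :
  (forall n, inH2 (g n)) -> inH2 f ->
  (forall eps, 0 < eps -> exists N, forall n, (N <= n)%nat -> N2 (fsub (g n) f) < eps) ->
  coef_lim g f.
Proof.
  intros Hg Hf H k eps He; destruct (H eps He) as [N HN]; exists N; intros n Hn.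
  eapply Rle_lt_trans; [|apply (HN n Hn)]. apply (coef_le_N2 (fsub (g n) f)); auto with h2.
Qed.

(** The coefficients converge in C; lower semicontinuity applied to [g n - g m] as n grows turns
    this into norm convergence. *)
Lemma H2_complete (g : nat -> fn) :
  (forall n, inH2 (g n)) ->
  (forall eps, 0 < eps -> exists N, forall n m, (N <= n)%nat -> (N <= m)%nat ->
     N2 (fsub (g n) (g m)) <= eps) ->
  exists f, inH2 f /\
    forall eps, 0 < eps -> exists N, forall n, (N <= n)%nat -> N2 (fsub f (g n)) <= eps.
Proof.
  intros Hg HC.
  assert (Hk : forall k, exists z : C, forall eps, 0 < eps -> exists N, forall n, (N <= n)%nat ->
            Cnorm2 (Csub (g n k) z) < eps).
  { intros k.
    assert (Hco : forall c : C -> R, (forall x y, (c x - c y)^2 <= Cnorm2 (Csub x y)) ->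
              ex_finite_lim_seq (fun n => c (g n k))).
    { intros c Hc. apply ex_lim_seq_cauchy_corr. intros eps.
      assert (He : 0 < eps * eps / 2) by (pose proof (cond_pos eps); nra).
      destruct (HC _ He) as [N HN]. exists N; intros n m Hn Hm.
      pose proof (coef_le_N2 (fsub (g n) (g m)) k ltac:(auto with h2)) as H1.
      specialize (HN n m Hn Hm). specialize (Hc (g n k) (g m k)). unfold fsub in H1 at 1.
      pose proof (cond_pos eps). apply Rabs_def1; nra. }
    destruct (Hco fst) as [a Ha];
      [intros x y; pose proof (pow2_ge_0 (snd x - snd y));
       unfold Cnorm2, Csub, Cadd, Copp; simpl; lra|].
    destruct (Hco snd) as [b Hb];
      [intros x y; pose proof (pow2_ge_0 (fst x - fst y));
       unfold Cnorm2, Csub, Cadd, Copp; simpl; lra|].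
    exists (a, b); intros eps He.
    apply is_lim_seq_Reals in Ha, Hb.
    set (d := Rmin 1 (eps / 4)).
    assert (Hd : 0 < d /\ d <= 1 /\ d <= eps / 4).
    { unfold d; split; [apply Rmin_pos; lra|split; [apply Rmin_l|apply Rmin_r]]. }
    destruct (Ha d) as [Na HNa]; [tauto|]. destruct (Hb d) as [Nb HNb]; [tauto|].
    exists (max Na Nb); intros n Hn.
    specialize (HNa n ltac:(lia)); specialize (HNb n ltac:(lia)).
    unfold Rdist in *; apply Rabs_def2 in HNa, HNb.
    unfold Cnorm2, Csub, Cadd, Copp; simpl; nra. }
  destruct (choice _ Hk) as [f Hf].
  assert (HL : forall m eps, 0 < eps ->
     (exists N, forall n, (N <= n)%nat -> N2 (fsub (g n) (g m)) <= eps) ->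
     inH2 (fsub f (g m)) /\ N2 (fsub f (g m)) <= eps).
  { intros m eps He [N HN]. apply (N2_lsc (fun n => fsub (g n) (g m))).
    - intros k e Hp; destruct (Hf k e Hp) as [N' HN']; exists N'; intros n Hn; unfold fsub.
      replace (Csub _ _) with (Csub (g n k) (f k)) by ring; auto.
    - exists N; intros n Hn; split; auto with h2. }
  exists f; split.
  - destruct (HC 1 Rlt_0_1) as [N HN].
    destruct (HL N 1 Rlt_0_1) as [H1 _]; [exists N; auto|].
    replace f with (fadd (fsub f (g N)) (g N)) by fn_solve. auto with h2.
  - intros eps He; destruct (HC eps He) as [N HN]; exists N; intros n Hn.
    apply HL; auto. exists N; auto.
Qed.

Section Subspace.
Variable L : fn -> Prop.
Hypothesis HL : closed_subspace L.

Lemma cs_fadd f g : L f -> L g -> L (fadd f g).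
Proof. apply (cs_add L HL). Qed.

Lemma cs_fscal c f : L f -> L (fscal c f).
Proof. apply (cs_scal L HL). Qed.

Lemma cs_fsub f g : L f -> L g -> L (fsub f g).
Proof. intros; rewrite fsub_E; apply cs_fadd; auto; apply cs_fscal; auto. Qed.

Lemma cs_limit f : inH2 f -> (forall eps, 0 < eps -> exists g, L g /\ N2 (fsub f g) < eps) -> L f.
Proof.
  intros Hf H; apply (cs_closed L HL f Hf); intros eps He.
  destruct (H eps He) as (g & Lg & Hg); exists g; split; auto.
  exists (N2 (fsub f g)); split; auto. apply N2_has_norm2.
  apply (inH2_fsub f g); auto. now apply (cs_H2 L HL).
Qed.

Lemma projection f : inH2 f -> exists g, L g /\ forall h, L h -> ip (fsub f g) h = C0.
Proof.
  intros Hf.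
  (* Squared distances are negated because [completeness] provides suprema. *)
  pose (E := fun x => exists g, L g /\ x = - N2 (fsub f g)).
  assert (LH : forall g, L g -> inH2 g) by apply (cs_H2 L HL).
  assert (Hb : bound E).
  { exists 0; intros x (g & Lg & ->). pose proof (N2_ge0 (fsub f g) ltac:(auto with h2)); lra. }
  destruct (completeness E Hb) as [d' [Hub Hlub]].
  { exists (- N2 (fsub f fzero)); exists fzero; split; auto. apply (cs_zero L HL). }
  set (d := - d').
  assert (Hd : forall g, L g -> d <= N2 (fsub f g)).
  { intros g Lg. assert (- N2 (fsub f g) <= d') by (apply Hub; exists g; auto). unfold d; lra. }
  assert (Hseq : forall n : nat, exists g, L g /\ N2 (fsub f g) < d + / (INR n + 1)).
  { intros n. apply NNPP; intros HN.
    assert (P : 0 < / (INR n + 1)) by (apply Rinv_0_lt_compat; pose proof (pos_INR n); lra).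
    assert (d' <= d' - / (INR n + 1)); [|lra].
    apply Hlub; intros x (g & Lg & ->). apply Rnot_lt_le; intros Hlt.
    apply HN; exists g; split; auto; unfold d; lra. }
  destruct (choice _ Hseq) as [g Hg].
  assert (Lg : forall n, L (g n)) by (intros n; apply Hg).
  assert (Hsmall : forall eps, 0 < eps -> exists N, forall n, (N <= n)%nat -> / (INR n + 1) < eps).
  { intros eps He. destruct (archimed_cor1 eps He) as (N & HN1 & HN2). exists N; intros n Hn.
    eapply Rlt_trans; [|exact HN1].
    apply Rinv_0_lt_contravar; [apply lt_0_INR; lia|]. apply le_INR in Hn; lra. }
  destruct (H2_complete g) as (g0 & Hg0 & Hlim); [auto| |].
  (* The midpoint of [g n] and [g m] is in L, hence at squared distance at least d; the
     parallelogram law then makes the minimizing sequence Cauchy. *)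
  { intros eps He. destruct (Hsmall (eps/4)) as [N HN]; [lra|]. exists N; intros n m Hn Hm.
    pose proof (parallelogram (fsub f (g m)) (fsub f (g n)) ltac:(auto with h2) ltac:(auto with h2)) as P.
    replace (fsub (fsub f (g m)) (fsub f (g n))) with (fsub (g n) (g m)) in P by fn_solve.
    replace (fadd (fsub f (g m)) (fsub f (g n)))
      with (fscal (2, 0) (fsub f (fscal (/2, 0) (fadd (g n) (g m))))) in P.
    2:{ apply functional_extensionality; intros k; unfold fscal, fsub, fadd; C_solve; field. }
    rewrite N2_fscal in P. replace (Cnorm2 (2, 0)) with 4 in P by (unfold Cnorm2; simpl; ring).
    pose proof (Hd _ (cs_fscal (/2,0) _ (cs_fadd _ _ (Lg n) (Lg m)))).
    pose proof (proj2 (Hg n)); pose proof (proj2 (Hg m)).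
    specialize (HN n Hn) as Kn; specialize (HN m Hm) as Km. lra. }
  assert (Lg0 : L g0).
  { apply cs_limit; auto. intros eps He. destruct (Hlim (eps/2)) as [N HN]; [lra|].
    exists (g N); split; auto. specialize (HN N (le_n N)); lra. }
  assert (Hmin : N2 (fsub f g0) <= d).
  { apply le_epsilon; intros eps He.
    apply (N2_lsc (fun n => fsub f (g n)) (fsub f g0)).
    - apply coef_lim_norm; auto with h2. intros e Hp; destruct (Hlim (e/2)) as [N HN]; [lra|].
      exists N; intros n Hn; replace (fsub _ _) with (fsub g0 (g n)) by fn_solve.
      specialize (HN n Hn); lra.
    - destruct (Hsmall eps He) as [N HN]; exists N; intros n Hn; split; auto with h2.
      pose proof (proj2 (Hg n)); specialize (HN n Hn); lra. }
  exists g0; split; auto. intros h Lh. set (w := fsub f g0) in *.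
  assert (Hw : inH2 w) by (unfold w; auto with h2). specialize (LH h Lh).
  apply Cnorm2_eq0. set (a := ip w h). pose proof (N2_ge0 h LH) as Hh.
  (* Moving [g0] by s a h changes the squared distance by -2 s |a|^2 + s^2 |a|^2 N2 h = - s (1 + s)
     |a|^2, so minimality forces a = 0. *)
  set (s := / (N2 h + 1)). assert (Hs : s * (N2 h + 1) = 1) by (unfold s; field; lra).
  pose proof (Hd (fadd g0 (fscal (Cmul (s, 0) a) h)) (cs_fadd _ _ Lg0 (cs_fscal _ _ Lh))) as H.
  replace (fsub f _) with (fsub w (fscal (Cmul (s, 0) a) h)) in H by (unfold w; fn_solve).
  rewrite N2_fsub, N2_fscal, ip_scal_r in H by auto with h2. fold a in H.
  rewrite Cnorm2_mul in H.
  replace (fst (Cmul (Cconj (Cmul (s, 0) a)) a)) with (s * Cnorm2 a) in H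
    by (unfold Cnorm2; simpl; ring).
  replace (Cnorm2 (s, 0)) with (s * s) in H by (unfold Cnorm2; simpl; ring).
  pose proof (Cnorm2_ge0 a) as Ha.
  assert (0 < s) by (apply Rinv_0_lt_compat; lra).
  assert (s * s * Cnorm2 a * N2 h = s * Cnorm2 a * (1 - s)) by (rewrite <- Hs; ring).
  nra.
Qed.
End Subspace.

(** * Contractive multipliers attaining their norm *)

Definition contractive (th : fn) : Prop :=
  forall f, inH2 f -> inH2 (cauchy th f) /\ N2 (cauchy th f) <= N2 f.

Definition isometric (th : fn) : Prop :=
  forall f, inH2 f -> inH2 (cauchy th f) /\ N2 (cauchy th f) = N2 f.

Lemma inH2_unshift (f : fn) : inH2 (shift f) -> inH2 f.
Proof. intros H; exact (inH2_tl _ H). Qed.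

(** Horner's scheme as an induction principle: every polynomial arises from 0 by steps f to c + z
    f. *)
Lemma poly_ind (P : fn -> Prop) :
  P fzero -> (forall c f, P f -> P (fadd (fscal c one) (shift f))) ->
  forall n f, (forall k, (n <= k)%nat -> f k = C0) -> P f.
Proof.
  intros H0 HS; induction n as [|n IH]; intros f Hf.
  - replace f with fzero; auto.
    apply functional_extensionality; intros k; symmetry; apply Hf; lia.
  - rewrite (hd_tl f); apply HS, IH. intros k Hk; apply Hf; lia.
Qed.

Section Contractive.
Variable th : fn.
Hypothesis Hth : contractive th.

Definition norm_attaining (f : fn) : Prop := inH2 f /\ N2 (cauchy th f) = N2 f.

Lemma norm_attaining_shift f : norm_attaining (shift f) <-> norm_attaining f.
Proof.
  unfold norm_attaining; rewrite cauchy_shift_r; split.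
  - intros [H E]; apply inH2_unshift in H; split; auto.
    rewrite !N2_shift in E by (auto; now apply Hth). exact E.
  - intros [H E]; split; [auto with h2|]. rewrite !N2_shift by (auto; now apply Hth). exact E.
Qed.

(* [N2 f - N2 (th f)] is a nonnegative quadratic form, so it satisfies the
   parallelogram law and its null vectors form a subspace. *)
Lemma defect_add f g : inH2 f -> inH2 g ->
  N2 (fadd f g) - N2 (cauchy th (fadd f g)) <=
  2 * (N2 f - N2 (cauchy th f)) + 2 * (N2 g - N2 (cauchy th g)).
Proof.
  intros Hf Hg.
  destruct (Hth f Hf) as [Tf _]; destruct (Hth g Hg) as [Tg _].
  destruct (Hth (fsub f g)) as [_ D]; auto with h2.
  pose proof (parallelogram f g Hf Hg). pose proof (parallelogram _ _ Tf Tg).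
  rewrite cauchy_add_r. rewrite cauchy_sub_r in D. lra.
Qed.

Lemma norm_attaining_closed_subspace : closed_subspace norm_attaining.
Proof.
  constructor.
  - intros f [H _]; exact H.
  - split; [exact inH2_fzero|]. change (fun _ => C0) with fzero. now rewrite cauchy_zero_r.
  - intros f g [Hf Ef] [Hg Eg]; split; [exact (inH2_fadd f g Hf Hg)|].
    change (fun n => Cadd (f n) (g n)) with (fadd f g).
    pose proof (defect_add f g Hf Hg). destruct (Hth (fadd f g)); auto with h2; lra.
  - intros c f [Hf Ef]; split; [exact (inH2_fscal c f Hf)|].
    change (fun n => Cmul c (f n)) with (fscal c f).
    rewrite cauchy_scal_r, !N2_fscal, Ef; reflexivity.
  - intros f Hf H; split; auto. destruct (Hth f Hf) as [H1 H2]. apply Rle_antisym; auto.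
    apply le_epsilon; intros eps He.
    (* Since g has no defect, the defect of f is at most twice that of f - g, hence at most 2 N2 (f
       - g). *)
    destruct (H (eps / 2)) as (g & [Hg Eg] & l & Hl & Hle); [lra|].
    apply has_norm2_N2 in Hl; change (N2 (fsub f g) = l) in Hl.
    pose proof (defect_add g (fsub f g) Hg ltac:(auto with h2)) as D.
    replace (fadd g (fsub f g)) with f in D by fn_solve.
    destruct (Hth (fsub f g)) as [T1 _]; auto with h2. pose proof (N2_ge0 _ T1). lra.
Qed.

Lemma closed_subspace_shift (L : fn -> Prop) :
  closed_subspace L -> closed_subspace (fun f => exists g, L g /\ f = shift g).
Proof.
  intros HL; constructor.
  - intros f (g & Lg & ->); apply inH2_shift, (cs_H2 L HL), Lg.
  - exists fzero; split; [apply (cs_zero L HL)|symmetry; apply shift_fzero].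
  - intros f f' (g & Lg & ->) (g' & Lg' & ->); exists (fadd g g'); split.
    + now apply (cs_add L HL).
    + fn_solve.
  - intros c f (g & Lg & ->); exists (fscal c g); split; [now apply (cs_scal L HL)|fn_solve].
  - intros f Hf H.
    assert (H' : forall eps, 0 < eps -> exists g, L g /\ N2 (fsub f (shift g)) < eps).
    { intros eps He; destruct (H eps He) as (f' & (g & Lg & ->) & l & Hl & Hle).
      apply has_norm2_N2 in Hl. exists g; split; auto. change (N2 (fsub f (shift g)) = l) in Hl; lra. }
    (* The constant coefficient is continuous in the norm and vanishes on shifts, so the limit f is
       again a shift. *)
    assert (E0 : f O = C0).
    { apply Cnorm2_eq0, Rle_antisym; [|apply Cnorm2_ge0]. apply le_epsilon; intros eps He.
      destruct (H' eps He) as (g & Lg & Hg). pose proof (cs_H2 L HL g Lg).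
      pose proof (coef_le_N2 (fsub f (shift g)) O ltac:(auto with h2)) as D.
      unfold fsub in D at 1; simpl in D. replace (Csub (f O) C0) with (f O) in D by ring. lra. }
    assert (Ef : f = shift (tl f)) by (rewrite (hd_tl f) at 1; rewrite E0; fn_solve).
    exists (tl f); split; auto. apply (cs_limit L HL); auto with h2.
    intros eps He; destruct (H' eps He) as (g & Lg & Hg); exists g; split; auto.
    pose proof (cs_H2 L HL g Lg). rewrite <- N2_shift by auto with h2.
    replace (shift (fsub (tl f) g)) with (fsub (shift (tl f)) (shift g)) by fn_solve.
    now rewrite <- Ef.
Qed.

(* A wandering vector [u] of the shift on the norm attaining subspace [K], i.e. a nonzero
   element of [K] orthogonal to [zK]; it is a multiple of an inner function. *)
Lemma wandering_vector p : norm_attaining p -> p <> fzero ->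
  exists u, norm_attaining u /\ u <> fzero /\
    forall f, norm_attaining f -> ip u (shift f) = C0.
Proof.
  intros Kp Hp.
  assert (Hm : exists m, p m <> C0).
  { apply not_all_ex_not; intros E; apply Hp, functional_extensionality; exact E. }
  destruct Hm as [m Hm]. destruct (factor_shift p m Hm) as (j & p' & -> & H0).
  assert (Kp' : norm_attaining p').
  { clear - Kp Hth. induction j as [|j IH]; auto. apply IH.
    exact (proj1 (norm_attaining_shift _) Kp). }
  pose proof norm_attaining_closed_subspace as KS.
  destruct (projection _ (closed_subspace_shift _ KS) p') as (g & (k & Kk & ->) & Horth);
    [apply Kp'|].
  exists (fsub p' (shift k)); split; [|split].
  (* The next goal holds because elements of zK vanish at 0, so subtracting the projection keeps the
     constant term of p', which is nonzero after the division by z^j. *)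
  - apply (cs_fsub _ KS); auto. now apply (proj2 (norm_attaining_shift _)).
  - intros E; apply H0. apply (f_equal (fun h : fn => h O)) in E.
    replace (p' O) with (Csub (p' O) C0) by ring. exact E.
  - intros f Kf; apply Horth; eauto.
Qed.

(** For a polynomial f the product u f stays in the shift invariant space K, so u is orthogonal to z
    u f and each Horner step adds squared norms: multiplication by u scales norms by exactly |u|.
    For general f only the resulting bound is kept. *)
Lemma wandering_multiplier u : norm_attaining u ->
  (forall f, norm_attaining f -> ip u (shift f) = C0) ->
  forall f, inH2 f -> N2 (cauchy u f) <= N2 u * N2 f.
Proof.
  intros Ku Hu. pose proof norm_attaining_closed_subspace as KS.
  assert (HP : forall n f, (forall k, (n <= k)%nat -> f k = C0) ->
    norm_attaining (cauchy u f) /\ inH2 f /\ N2 (cauchy u f) = N2 u * N2 f).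
  { apply poly_ind.
    - rewrite cauchy_zero_r, N2_fzero, Rmult_0_r. repeat split; auto with h2. apply (cs_zero _ KS).
    - intros c f (Kf & Hf & E).
      rewrite cauchy_add_r, cauchy_scal_r, cauchy_one_r, cauchy_shift_r.
      destruct Ku as [Iu Eu] eqn:EK; clear EK. pose proof (proj1 Kf).
      split; [|split].
      + apply (cs_fadd _ KS); [apply (cs_fscal _ KS); auto|]. now apply (proj2 (norm_attaining_shift _)).
      + auto with h2.
      + rewrite !N2_orth_add; auto with h2.
        * rewrite !N2_fscal, !N2_shift, N2_one, E by auto. ring.
        * rewrite ip_scal_l, ip_sym, ip_shift_one by auto with h2. C_solve.
        * rewrite ip_scal_l, Hu by auto with h2. ring. }
  intros f Hf. apply inH2_bounded; intros n.
  destruct (HP (S n) (trunc (S n) f)) as ([Ht _] & _ & E); [intros; now apply trunc_ge|].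
  apply Rle_trans with (N2 (cauchy u (trunc (S n) f))).
  (* The coefficients of u f up to n see only the coefficients of f up to n. *)
  - eapply Rle_trans; [|apply (partial_le_N2 _ n Ht)]. right; apply sum_eq; intros i Hi.
    f_equal; apply cauchy_local; intros k Hk; symmetry; apply trunc_lt; lia.
  - rewrite E; apply Rmult_le_compat_l; [apply N2_ge0, Ku|now apply N2_trunc_le].
Qed.

(** For the wandering vector u, N2 u = N2 (u th) <= N2 u * N2 th, so [th] has norm at least 1 and
    the constant 1 attains the norm. Shift invariance then gives all polynomials, and closedness all
    of H^2. *)
Lemma contractive_isometric p : inH2 p -> p <> fzero -> N2 (cauchy th p) = N2 p -> isometric th.
Proof.
  intros Hp Hnz E. destruct (wandering_vector p) as (u & Ku & Hu & Horth); auto.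
  { split; auto. }
  pose proof norm_attaining_closed_subspace as KS.
  assert (K1 : norm_attaining one).
  { split; auto with h2. destruct (Hth one) as [H1 H2]; auto with h2.
    rewrite cauchy_one_r in *. apply Rle_antisym; auto. rewrite N2_one.
    pose proof (wandering_multiplier u Ku Horth th H1) as H3.
    rewrite cauchy_comm, (proj2 Ku) in H3.
    pose proof (N2_ge0 u (proj1 Ku)). destruct (Req_dec (N2 u) 0) as [Z|Z].
    - elim Hu; apply N2_eq0; auto; apply Ku.
    - apply Rmult_le_reg_l with (N2 u); lra. }
  intros f Hf; split; [now apply Hth|]. cut (norm_attaining f); [intros [_ H]; exact H|].
  apply (cs_limit _ KS); auto. intros eps He. destruct (N2_tail_small f eps Hf He) as [N HN].
  exists (trunc N f); split; [|apply HN; lia].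
  apply (poly_ind norm_attaining) with (n := N); [apply (cs_zero _ KS)| |intros; now apply trunc_ge].
  intros c g Kg; apply (cs_fadd _ KS); [now apply (cs_fscal _ KS)|now apply (proj2 (norm_attaining_shift _))].
Qed.
End Contractive.

(** * The colligation attached to [M] *)

Lemma coef_lim_cauchy a g f : coef_lim g f ->
  coef_lim (fun n => cauchy a (g n)) (cauchy a f).
Proof.
  intros H k; revert a; induction k as [|k IH]; intros a eps He.
  - set (A := Cnorm2 (a O)). pose proof (Cnorm2_ge0 (a O)).
    assert (HA : 0 < A + 1) by (unfold A; lra).
    destruct (H O (eps / (A + 1))) as [N HN]; [now apply Rdiv_lt_0_compat|].
    exists N; intros n Hn; specialize (HN n Hn). rewrite !cauchy_O.
    replace (Csub _ _) with (Cmul (a O) (Csub (g n O) (f O))) by ring. rewrite Cnorm2_mul.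
    fold A. apply Rmult_lt_compat_l with (1 := HA) in HN.
    replace ((A + 1) * (eps / (A + 1))) with eps in HN by (field; lra).
    pose proof (Cnorm2_ge0 (Csub (g n O) (f O))). lra.
  - set (A := Cnorm2 (a O)). pose proof (Cnorm2_ge0 (a O)).
    assert (HA : 0 < 4 * (A + 1)) by (unfold A; lra).
    destruct (H (S k) (eps / (4 * (A + 1)))) as [N1 HN1]; [now apply Rdiv_lt_0_compat|].
    destruct (IH (tl a) (eps / 4)) as [N2' HN2]; [lra|].
    exists (max N1 N2'); intros n Hn.
    specialize (HN1 n ltac:(lia)); specialize (HN2 n ltac:(lia)). rewrite !cauchy_S.
    replace (Csub _ _) with (Cadd (Cmul (a O) (Csub (g n (S k)) (f (S k))))
      (Csub (cauchy (tl a) (g n) k) (cauchy (tl a) f k))) by ring.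
    eapply Rle_lt_trans; [apply (Cnorm2_add_le _ _ 1 Rlt_0_1)|]. rewrite Cnorm2_mul, Rinv_1.
    fold A. apply Rmult_lt_compat_l with (1 := HA) in HN1.
    replace (4 * (A + 1) * (eps / (4 * (A + 1)))) with eps in HN1 by (field; lra).
    pose proof (Cnorm2_ge0 (Csub (g n (S k)) (f (S k)))). lra.
Qed.

Section Colligation.
Variables (M : fn -> Prop) (p q : fn).
Hypothesis HM : closed_subspace M.
Hypothesis Mp : M p.
Hypothesis Mq : M q.
Hypothesis Up : unit_vec p.
Hypothesis Uq : unit_vec q.
Hypothesis Hpq : forall f, (M f /\ orth f p) <-> (exists g, M g /\ orth g q /\ f = shift g).

Let Hp : inH2 p. Proof. exists 1; exact Up. Qed.
Let Hq : inH2 q. Proof. exists 1; exact Uq. Qed.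
Let Np : N2 p = 1. Proof. now apply has_norm2_N2. Qed.
Let Nq : N2 q = 1. Proof. now apply has_norm2_N2. Qed.
Let MH f : M f -> inH2 f. Proof. apply (cs_H2 M HM). Qed.

Lemma unit_nonzero : p <> fzero.
Proof. intros E; assert (H := Np); rewrite E, N2_fzero in H; lra. Qed.

(* The unitary [M + C -> C + M], [(f, u) |-> (<f,p>, S^*(f - <f,p>p) + u q)]. *)
Definition step (f : fn) (u : C) : fn := fadd (tl (fsub f (fscal (ip f p) p))) (fscal u q).

Lemma ip_residual f : M f -> ip (fsub f (fscal (ip f p) p)) p = C0.
Proof.
  intros Mf; pose proof (MH f Mf).
  rewrite ip_sub_l, ip_scal_l, ip_self, Np by auto with h2. change (1, 0) with C1; ring.
Qed.

(** The residual of f lies in M and is orthogonal to p, so the hypothesis on M writes it as z g with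
    g orthogonal to q; the two terms are orthogonal. *)
Lemma M_decomposition f : M f ->
  exists g, M g /\ ip g q = C0 /\ f = fadd (fscal (ip f p) p) (shift g) /\
    N2 f = Cnorm2 (ip f p) + N2 g.
Proof.
  intros Mf; pose proof (MH f Mf) as Hf.
  destruct (proj1 (Hpq (fsub f (fscal (ip f p) p)))) as (g & Mg & Og & E).
  - split; [apply (cs_fsub M HM); auto; now apply (cs_fscal M HM)|].
    apply orth_iff; auto with h2; now apply ip_residual.
  - pose proof (MH g Mg) as Hg. exists g; split; auto. split; [now apply inner_prod_ip|].
    assert (Ef : f = fadd (fscal (ip f p) p) (shift g)) by (rewrite <- E; fn_solve).
    split; auto. rewrite Ef at 1. rewrite N2_orth_add by
      (auto with h2; rewrite <- E, ip_scal_l, (ip_sym (fsub _ _) p), ip_residual by auto with h2; C_solve).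
    rewrite N2_fscal, N2_shift, Np by auto. ring.
Qed.

Lemma step_spec f u : M f -> M (step f u) /\
  f = fsub (fadd (fscal (ip f p) p) (shift (step f u))) (fscal u (shift q)) /\
  Cnorm2 (ip f p) + N2 (step f u) = N2 f + Cnorm2 u.
Proof.
  intros Mf. destruct (M_decomposition f Mf) as (g & Mg & Og & Ef & Nf).
  pose proof (MH g Mg).
  assert (E : step f u = fadd g (fscal u q)).
  { unfold step. rewrite Ef at 1. fn_solve. }
  rewrite E; split; [apply (cs_fadd M HM); auto; now apply (cs_fscal M HM)|split].
  - rewrite Ef at 1. fn_solve.
  - rewrite N2_orth_add, N2_fscal, Nq by (auto with h2; rewrite ip_scal_r, Og by auto with h2; ring).
    lra.
Qed.

(** Output at time n of the system started in the state [f] with inputs [u 0], [u 1], ...; the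
    generating function of the outputs is [output f u]. *)
Fixpoint out_coef (n : nat) (f u : fn) : C :=
  match n with O => ip f p | S m => out_coef m (step f (u O)) (tl u) end.

Definition output (f u : fn) : fn := fun n => out_coef n f u.

(** One time step is the identity f + u_0 z q = <f,p> p + z (step f u_0); iterating it produces the
    coefficients one at a time. *)
Lemma output_eq f u : M f -> cauchy p (output f u) = fadd f (shift (cauchy q u)).
Proof.
  intros Mf; apply functional_extensionality; intros n; revert f u Mf.
  induction n as [|n IH]; intros f u Mf;
  destruct (step_spec f (u O) Mf) as (Ms & Ef & _);
  rewrite (cauchy_comm p), (hd_tl (output f u)), cauchy_add_l, cauchy_scal_l, cauchy_one_l,
    cauchy_shift_l, (cauchy_comm _ p);
  change (output f u O) with (ip f p); change (tl (output f u)) with (output (step f (u O)) (tl u));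
  apply (f_equal (fun h : fn => h O)) in Ef as E0.
  - unfold fadd, fsub, fscal, shift in *; rewrite E0; ring.
  - apply (f_equal (fun h : fn => h (S n))) in Ef as E1.
    unfold fadd, fscal in *. cbn [shift] in *. rewrite IH by exact Ms.
    assert (Eu : cauchy q u = fadd (fscal (u O) q) (shift (cauchy q (tl u)))).
    { rewrite (hd_tl u) at 1.
      now rewrite cauchy_add_r, cauchy_scal_r, cauchy_one_r, cauchy_shift_r. }
    rewrite Eu, E1. unfold fadd, fsub, fscal; cbn [shift]. ring.
Qed.

(** Telescoping of the energy balance in [step_spec]; the norm of the final state is dropped. *)
Lemma output_energy n f u : M f ->
  sum_f_R0 (fun k => Cnorm2 (output f u k)) n <= N2 f + sum_f_R0 (fun k => Cnorm2 (u k)) n.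
Proof.
  revert f u; induction n as [|n IH]; intros f u Mf;
  destruct (step_spec f (u O) Mf) as (Ms & _ & E).
  - simpl; change (output f u O) with (ip f p). pose proof (N2_ge0 _ (MH _ Ms)); lra.
  - rewrite !(decomp_sum _ (S n)) by lia. simpl pred.
    specialize (IH _ (tl u) Ms). change (output f u O) with (ip f p).
    change (fun i => Cnorm2 (output f u (S i))) with
      (fun k => Cnorm2 (output (step f (u O)) (tl u) k)).
    change (fun i => Cnorm2 (u (S i))) with (fun k => Cnorm2 (tl u k)). lra.
Qed.

Lemma output_norm f u : M f -> inH2 u -> inH2 (output f u) /\ N2 (output f u) <= N2 f + N2 u.
Proof.
  intros Mf Hu; apply inH2_bounded; intros n.
  pose proof (output_energy n f u Mf); pose proof (partial_le_N2 u n Hu); lra.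
Qed.

(** The formal quotient q/p, obtained by letting the system run freely from the state q. *)
Definition theta : fn := output q fzero.

Lemma theta_spec : cauchy p theta = q.
Proof.
  unfold theta; rewrite output_eq, cauchy_zero_r, shift_fzero by auto. fn_solve.
Qed.

(** Both sides have the same product with p, namely f + z q u, so p can be cancelled. *)
Lemma output_theta f u : M f ->
  output f u = fadd (output f fzero) (shift (cauchy theta u)).
Proof.
  intros Mf; apply (cauchy_cancel p _ _ unit_nonzero).
  rewrite cauchy_add_r, !output_eq by auto.
  rewrite cauchy_zero_r, shift_fzero, cauchy_shift_r, <- cauchy_assoc, theta_spec. fn_solve.
Qed.

Lemma output_fzero : output fzero fzero = fzero.
Proof.
  apply (cauchy_cancel p _ _ unit_nonzero).
  rewrite output_eq, !cauchy_zero_r, shift_fzero by apply (cs_zero M HM). fn_solve.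
Qed.

(** From the zero state the output is z theta u, and the energy inequality compares it with the
    input u. *)
Lemma theta_contractive : contractive theta.
Proof.
  intros u Hu. pose proof (cs_zero M HM : M fzero) as M0.
  destruct (output_norm fzero u M0 Hu) as [H1 H2].
  rewrite (output_theta _ _ M0), output_fzero in H1, H2.
  replace (fadd fzero _) with (shift (cauchy theta u)) in H1, H2 by fn_solve.
  apply inH2_unshift in H1; rewrite N2_shift, N2_fzero in H2 by auto. split; auto; lra.
Qed.

Lemma theta_isometric : isometric theta.
Proof.
  apply (contractive_isometric theta theta_contractive p); auto using unit_nonzero.
  rewrite cauchy_comm, theta_spec, Nq, Np; reflexivity.
Qed.

Lemma RanH_iff f : RanH theta f <->
  inH2 f /\ forall g, inH2 g -> ip f (shift (cauchy theta g)) = C0.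
Proof.
  unfold RanH; split; intros [Hf H]; split; auto; intros g Hg;
  apply orth_iff; auto; apply inH2_shift, theta_isometric, Hg.
Qed.

(** The quotient h = f/p is the free output. Feeding in a multiple c g adds c z theta g to h; since
    theta is isometric, the quadratic terms in the energy inequality cancel and only the cross term
    remains, which must vanish. *)
Lemma M_RanH f : M f ->
  exists h, RanH theta h /\ f = cauchy p h /\ N2 h <= N2 f.
Proof.
  intros Mf; pose proof (N2_ge0 f (MH f Mf)) as Nf. exists (output f fzero).
  destruct (output_norm f fzero Mf inH2_fzero) as [H1 H2]. rewrite N2_fzero in H2.
  split; [|split; [|lra]].
  2:{ rewrite output_eq, cauchy_zero_r, shift_fzero by auto; fn_solve. }
  apply RanH_iff; split; auto. intros g Hg. set (h := output f fzero) in *.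
  destruct (theta_isometric g Hg) as [Tg Ng].
  apply Cnorm2_eq0. set (a := ip h (shift (cauchy theta g))).
  destruct (Req_dec (Cnorm2 a) 0) as [|Z]; auto. exfalso.
  pose proof (Cnorm2_ge0 a) as Ha.
  (* With c = s a the inequality reads N2 h + 2 s |a|^2 <= N2 f, which this s contradicts. *)
  set (s := (N2 f + 1) / Cnorm2 a).
  destruct (output_norm f (fscal (Cmul (s, 0) a) g) Mf ltac:(auto with h2)) as [_ H].
  rewrite output_theta, cauchy_scal_r in H by auto. fold h in H.
  replace (shift (fscal (Cmul (s, 0) a) (cauchy theta g)))
    with (fscal (Cmul (s, 0) a) (shift (cauchy theta g))) in H by fn_solve.
  rewrite N2_fadd, ip_scal_r, !N2_fscal, N2_shift, Ng in H by auto with h2.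
  fold a in H. replace (fst (Cmul (Cconj (Cmul (s, 0) a)) a)) with (s * Cnorm2 a) in H
    by (unfold Cnorm2; simpl; ring).
  replace (s * Cnorm2 a) with (N2 f + 1) in H by (unfold s; field; auto).
  pose proof (N2_ge0 h H1). lra.
Qed.

Lemma RanH_sub f g : RanH theta f -> RanH theta g -> RanH theta (fsub f g).
Proof.
  rewrite !RanH_iff; intros [Hf Of] [Hg Og]; split; auto with h2; intros k Hk.
  rewrite ip_sub_l, Of, Og by (auto; apply inH2_shift, theta_isometric, Hk). ring.
Qed.

(* Running the colligation backwards from the zero state: [F] is [p] times the projection of the
   polynomial [c] onto [Ran H_theta]. *)
Lemma backward n : forall c, (forall k, (n <= k)%nat -> c k = C0) ->
  inH2 c /\ exists F V, M F /\ inH2 V /\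
    F = cauchy p (fsub c (shift (cauchy theta V))) /\ N2 F = N2 c - N2 V.
Proof.
  apply poly_ind.
  - split; auto with h2. exists fzero, fzero.
    rewrite cauchy_zero_r, shift_fzero, N2_fzero. repeat split; auto with h2; try lra.
    + apply (cs_zero M HM).
    + replace (fsub fzero fzero) with fzero by fn_solve. now rewrite cauchy_zero_r.
  (* From the state F for c to that for a + z c: remove the q-component v of F to get G, shift G
     into M, add a p, and record v as the new constant term of V. *)
  - intros a c (Hc & F & V & MF & HV & EF & NF). split; auto with h2.
    pose proof (MH F MF) as HF. set (v := ip F q). set (G := fsub F (fscal v q)).
    assert (MG : M G) by (apply (cs_fsub M HM); auto; now apply (cs_fscal M HM)).
    pose proof (MH G MG) as HG.
    assert (Gq : ip G q = C0).
    { unfold G; rewrite ip_sub_l, ip_scal_l, ip_self, Nq by auto with h2. change (1, 0) with C1.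
      unfold v; ring. }
    assert (NG : N2 F = Cnorm2 v + N2 G).
    { replace F with (fadd (fscal v q) G) at 1 by (unfold G; fn_solve).
      rewrite N2_orth_add by
        (auto with h2; rewrite ip_scal_l, ip_sym, Gq by auto; C_solve).
      rewrite N2_fscal, Nq; ring. }
    destruct (proj2 (Hpq (shift G))) as [MSG OSG].
    { exists G; split; auto. split; auto. now apply orth_iff. }
    apply inner_prod_ip in OSG.
    exists (fadd (fscal a p) (shift G)), (fadd (fscal v one) (shift V)).
    repeat split; auto with h2.
    + apply (cs_fadd M HM); auto; now apply (cs_fscal M HM).
    + unfold G. rewrite EF, <- theta_spec.
      repeat first [rewrite cauchy_sub_r | rewrite cauchy_add_r | rewrite cauchy_scal_r
        | rewrite cauchy_shift_r | rewrite cauchy_one_r].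
      fn_solve.
    + assert (Eo : forall d g, inH2 g -> N2 (fadd (fscal d one) (shift g)) = Cnorm2 d + N2 g).
      { intros d g Hg. rewrite N2_hd_tl by auto with h2. f_equal.
        - unfold fadd, fscal; simpl; f_equal; ring.
        - f_equal; fn_solve. }
      rewrite !Eo by auto. rewrite N2_orth_add by
        (auto with h2; rewrite ip_scal_l, ip_sym, OSG by auto with h2; C_solve).
      rewrite N2_fscal, N2_shift, Np by auto. lra.
Qed.

(** The state reached lies in M, so [M_RanH] places its quotient by p in Ran H_theta. The splitting
    of c is then orthogonal, and the backward energy balance becomes the isometry of p on H. *)
Lemma backward_proj n c : (forall k, (n <= k)%nat -> c k = C0) ->
  exists H V, RanH theta H /\ inH2 V /\ M (cauchy p H) /\
    c = fadd H (shift (cauchy theta V)) /\ N2 (cauchy p H) = N2 H.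
Proof.
  intros Hc; destruct (backward n c Hc) as (Ic & F & V & MF & HV & EF & NF).
  destruct (M_RanH F MF) as (H & RH & EH & _).
  assert (E : H = fsub c (shift (cauchy theta V))).
  { apply (cauchy_cancel p _ _ unit_nonzero); congruence. }
  assert (Ec : c = fadd H (shift (cauchy theta V))) by (rewrite E; fn_solve).
  exists H, V; rewrite <- EH.
  split; [exact RH|]. split; [exact HV|]. split; [exact MF|]. split; [exact Ec|].
  apply RanH_iff in RH; destruct RH as [IH OH]. destruct (theta_isometric V HV) as [TV NV].
  rewrite NF, Ec, N2_orth_add, N2_shift, NV by auto with h2. ring.
Qed.

Lemma theta_range_orth V : inH2 V -> RanH theta (shift (cauchy theta V)) ->
  shift (cauchy theta V) = fzero.
Proof.
  intros HV RV; apply RanH_iff in RV; destruct RV as [I O]. apply N2_eq0; auto.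
  specialize (O V HV). rewrite ip_self in O. exact (f_equal fst O).
Qed.

(** The projections [H n] of the truncations of h converge to h in norm, and p is isometric on them
    and on their differences. Coefficientwise, p H_n tends to p h, which identifies the norm limit
    in M. *)
Lemma RanH_M h : RanH theta h ->
  M (cauchy p h) /\ N2 (cauchy p h) = N2 h.
Proof.
  intros Rh. destruct (proj1 (RanH_iff h) Rh) as [Hh Oh].
  assert (HT : forall n, exists H, RanH theta H /\ M (cauchy p H) /\
     N2 (fsub h H) <= N2 (fsub h (trunc n h)) /\ N2 (cauchy p H) <= N2 h /\
     exists V, inH2 V /\ trunc n h = fadd H (shift (cauchy theta V))).
  { intros n; destruct (backward_proj n (trunc n h)) as (H & V & RH & HV & MF & Ec & NF);
      [intros; now apply trunc_ge|].
    pose proof (proj1 (RanH_iff H) RH) as [IH OH].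
    assert (NH : N2 (cauchy p H) <= N2 h).
    { destruct (theta_isometric V HV) as [TV NV].
      rewrite NF. apply Rle_trans with (N2 (trunc n h)); [|now apply N2_trunc_le].
      rewrite Ec, N2_orth_add by auto with h2. pose proof (N2_ge0 (shift (cauchy theta V))).
      assert (inH2 (shift (cauchy theta V))) by auto with h2. intuition lra. }
    exists H; split; [exact RH|]. split; [exact MF|]. split; [|split; [exact NH|exists V; auto]].
    pose proof (RanH_sub _ _ Rh RH) as RD. apply RanH_iff in RD; destruct RD as [ID OD].
    destruct (theta_isometric V HV) as [TV NV].
    rewrite Ec. replace (fsub h (fadd H (shift (cauchy theta V)))) with
      (fadd (fsub h H) (fscal (Copp C1) (shift (cauchy theta V)))) by fn_solve.
    rewrite N2_orth_add, N2_fscal; auto with h2.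
    - assert (0 <= Cnorm2 (Copp C1) * N2 (shift (cauchy theta V))); [|lra].
      apply Rmult_le_pos; [apply Cnorm2_ge0|apply N2_ge0; auto with h2].
    - rewrite ip_scal_r, OD by auto with h2; ring. }
  destruct (choice _ HT) as [H HH]; clear HT.
  assert (IH : forall n, inH2 (H n)) by (intros n; apply (proj1 (RanH_iff _) (proj1 (HH n)))).
  assert (MF : forall n, M (cauchy p (H n))) by (intros n; apply HH).
  assert (Hlim : forall eps, 0 < eps -> exists N, forall n, (N <= n)%nat -> N2 (fsub (H n) h) < eps).
  { intros eps He; destruct (N2_tail_small h eps Hh He) as [N HN]; exists N; intros n Hn.
    rewrite N2_sub_sym. destruct (HH n) as (_ & _ & Hle & _ & _); specialize (HN n Hn); lra. }
  assert (Hcl : coef_lim H h) by (apply coef_lim_norm; auto).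
  assert (Hpcl : coef_lim (fun n => cauchy p (H n)) (cauchy p h)).
  { now apply coef_lim_cauchy. }
  (* The difference of truncations is a polynomial; its projection D is [H n - H m], because the two
     differ by an element of both Ran H_theta and z theta H^2. *)
  assert (Hiso : forall n m, N2 (fsub (cauchy p (H n)) (cauchy p (H m))) = N2 (fsub (H n) (H m))).
  { intros n m. destruct (HH n) as (Rn & _ & _ & _ & Vn & IVn & En).
    destruct (HH m) as (Rm & _ & _ & _ & Vm & IVm & Em).
    destruct (backward_proj (max n m) (fsub (trunc n h) (trunc m h)))
      as (D & V & RD & HV & MD & Ec & ND).
    { intros k Hk; unfold fsub; rewrite !trunc_ge by lia; ring. }
    rewrite En, Em in Ec.
    assert (Z : shift (cauchy theta (fsub V (fsub Vn Vm))) = fsub (fsub (H n) (H m)) D).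
    { assert (EV : shift (cauchy theta V) = fsub (fadd D (shift (cauchy theta V))) D) by fn_solve.
      rewrite <- Ec in EV. rewrite !cauchy_sub_r.
      replace (shift (fsub _ _)) with (fsub (shift (cauchy theta V))
        (fsub (shift (cauchy theta Vn)) (shift (cauchy theta Vm)))) by fn_solve.
      rewrite EV; fn_solve. }
    assert (E : fsub (H n) (H m) = D).
    { assert (Z' : fsub (fsub (H n) (H m)) D = fzero).
      { rewrite <- Z; apply theta_range_orth; auto with h2. rewrite Z.
        apply RanH_sub; auto; now apply RanH_sub. }
      replace (fsub (H n) (H m)) with (fadd (fsub (fsub (H n) (H m)) D) D) by fn_solve.
      rewrite Z'; fn_solve. }
    rewrite <- cauchy_sub_r, E; exact ND. }
  assert (Hconv : forall eps, 0 < eps -> exists m,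
     inH2 (fsub (cauchy p h) (cauchy p (H m))) /\ N2 (fsub (cauchy p h) (cauchy p (H m))) < eps).
  (* Twice the sum of two errors eps/8 bounds [H n - H N] by eps/2; lower semicontinuity passes to
     the limit in n. *)
  { intros eps He; destruct (Hlim (eps / 8)) as [N HN]; [lra|]. exists N.
    cut (inH2 (fsub (cauchy p h) (cauchy p (H N))) /\
         N2 (fsub (cauchy p h) (cauchy p (H N))) <= eps / 2); [intros [? ?]; split; auto; lra|].
    apply (N2_lsc (fun n => fsub (cauchy p (H n)) (cauchy p (H N)))).
    - intros k e Hp'; destruct (Hpcl k e Hp') as [N' HN']; exists N'; intros n Hn; unfold fsub.
      replace (Csub (Csub _ _) _) with (Csub (cauchy p (H n) k) (cauchy p h k)) by ring; auto.
    - exists N; intros n Hn; split; [apply inH2_fsub; auto|]. rewrite Hiso.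
      replace (fsub (H n) (H N)) with (fadd (fsub (H n) h) (fsub h (H N))) by fn_solve.
      pose proof (N2_add_le (fsub (H n) h) (fsub h (H N)) 1
        ltac:(auto with h2) ltac:(auto with h2) Rlt_0_1) as B.
      rewrite Rinv_1 in B. rewrite (N2_sub_sym h) in B.
      pose proof (HN n Hn); pose proof (HN N (le_n N)). lra. }
  assert (Mph : M (cauchy p h)).
  { apply (cs_limit M HM).
    - destruct (Hconv 1 Rlt_0_1) as (m & Im & _).
      replace (cauchy p h) with (fadd (fsub (cauchy p h) (cauchy p (H m))) (cauchy p (H m)))
        by fn_solve. apply inH2_fadd; auto.
    - intros eps He; destruct (Hconv eps He) as (m & _ & Hm). eauto. }
  split; auto. apply Rle_antisym.
  - apply (N2_lsc (fun n => cauchy p (H n))); auto. exists O; intros n _; split; auto. apply HH.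
  (* The reverse inequality: p h is in M, and its quotient by p, which is h, has no larger norm. *)
  - destruct (M_RanH _ Mph) as (h' & _ & E & Hle).
    apply (cauchy_cancel p _ _ unit_nonzero) in E. now rewrite <- E in Hle.
Qed.
End Colligation.

(** * Covering lemmas *)

Definition len (I : R * R) : R := snd I - fst I.
Definition total (l : list (R * R)) : R := fold_right (fun I x => len I + x) 0 l.
Definition wf (l : list (R * R)) : Prop := Forall (fun I => fst I <= snd I) l.
Definition covered (l : list (R * R)) (t : R) : Prop := exists I, In I l /\ fst I < t < snd I.

Lemma total_app l l' : total (l ++ l') = total l + total l'.
Proof. induction l as [|I l IH]; simpl; [lra|rewrite IH; lra]. Qed.

Lemma total_ge0 l : wf l -> 0 <= total l.
Proof. induction 1; simpl; unfold len; lra. Qed.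

Lemma covered_app l l' t : covered (l ++ l') t <-> covered l t \/ covered l' t.
Proof.
  split.
  - intros (I & HI & Ht); apply in_app_or in HI; destruct HI; [left|right]; exists I; auto.
  - intros [(I & HI & Ht)|(I & HI & Ht)]; exists I; split; auto; apply in_or_app; auto.
Qed.

Lemma sum_nth_le_total l n : wf l ->
  sum_f_R0 (fun k => len (nth k l (0, 0))) n <= total l.
Proof.
  intros H; revert n; induction H as [|I l HI Hl IH]; intros n.
  - right; simpl. rewrite (sum_eq _ (fun _ => 0)), sum_cte; [ring|].
    intros [|k] _; unfold len; simpl; ring.
  - destruct n as [|n].
    + simpl. pose proof (total_ge0 l Hl); lra.
    + rewrite decomp_sum by lia. simpl. specialize (IH n). lra.
Qed.

Fixpoint concat_upto (ls : nat -> list (R * R)) (n : nat) : list (R * R) :=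
  match n with O => nil | S m => concat_upto ls m ++ ls m end.

Lemma concat_upto_nth ls n m k : (forall i, (1 <= length (ls i))%nat) -> (k < n)%nat -> (n <= m)%nat ->
  nth k (concat_upto ls m) (0, 0) = nth k (concat_upto ls n) (0, 0).
Proof.
  intros Hl Hk Hm; induction Hm as [|m Hm IH]; auto.
  simpl; rewrite app_nth1; auto.
  assert (HL : forall i, (i <= length (concat_upto ls i))%nat).
  { induction i as [|i IHi]; simpl; [lia|]. rewrite length_app. specialize (Hl i). lia. }
  specialize (HL m); lia.
Qed.

Lemma sum_half_pow K n : sum_f_R0 (fun i => (/ 2) ^ (K + i)) n <= 2 * (/ 2) ^ K.
Proof.
  assert (H : sum_f_R0 (fun i => (/ 2) ^ (K + i)) n = 2 * (/ 2) ^ K - (/ 2) ^ (K + n)).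
  { induction n as [|n IH]; simpl; [rewrite Nat.add_0_r; lra|].
    rewrite IH, Nat.add_succ_r; simpl; lra. }
  pose proof (pow_lt (/ 2) (K + n) ltac:(lra)). lra.
Qed.

Lemma half_pow_small c eps : 0 < eps -> exists K, forall k, (K <= k)%nat -> c * (/ 2) ^ k < eps.
Proof.
  intros He. set (d := eps / (Rabs c + 1)).
  pose proof (Rabs_pos c). assert (Hd : 0 < d) by (apply Rdiv_lt_0_compat; lra).
  destruct (pow_lt_1_zero (/ 2) ltac:(rewrite Rabs_pos_eq; lra) d Hd) as [K HK].
  exists K; intros k Hk; specialize (HK k Hk).
  pose proof (pow_lt (/ 2) k ltac:(lra)) as P. rewrite Rabs_pos_eq in HK by lra.
  assert (E : d * (Rabs c + 1) = eps) by (unfold d; field; lra).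
  apply Rle_lt_trans with (Rabs c * (/ 2) ^ k); [apply Rmult_le_compat_r; [lra|apply Rle_abs]|].
  apply Rlt_le_trans with ((Rabs c + 1) * (/ 2) ^ k).
  - apply Rmult_lt_compat_r; lra.
  - rewrite <- E, Rmult_comm. apply Rmult_le_compat_r; lra.
Qed.

(** The Borel-Cantelli argument: the lists from K on have total length at most 2 c 2^-K and cover
    the limsup set. *)
Lemma null_limsup (ls : nat -> list (R * R)) c :
  (forall k, wf (ls k) /\ total (ls k) <= c * (/ 2) ^ k) ->
  null_set (fun t => forall K, exists k, (K <= k)%nat /\ covered (ls k) t).
Proof.
  intros H eps He. destruct (half_pow_small (2 * c) eps He) as [K HK].
  (* The degenerate interval makes every list nonempty, so the first k + 1 lists already contain an
     entry of index k and [J] below enumerates all intervals consistently. *)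
  set (ls' := fun i => (0, 0) :: ls (K + i)%nat).
  assert (Hl : forall i, (1 <= length (ls' i))%nat) by (intros; simpl; lia).
  assert (ET : forall i, total (ls' i) = total (ls (K + i)%nat))
    by (intros; unfold ls', len; simpl; unfold len; simpl; ring).
  assert (Hwf : forall n, wf (concat_upto ls' n)).
  { induction n as [|n IH]; simpl; [constructor|]. apply Forall_app; split; auto.
    constructor; [simpl; lra|apply H]. }
  set (J := fun k => nth k (concat_upto ls' (S k)) (0, 0)).
  exists (fun k => fst (J k)), (fun k => snd (J k)). split; [|split].
  - intros k. unfold J. pose proof (Hwf (S k)) as W. unfold wf in W; rewrite Forall_nth in W.
    destruct (le_lt_dec (length (concat_upto ls' (S k))) k) as [L|L].
    + rewrite nth_overflow by exact L. simpl; lra.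
    + now apply W.
  - intros N.
    apply Rle_trans with (sum_f_R0 (fun k => len (nth k (concat_upto ls' (S N)) (0, 0))) N).
    + right; apply sum_eq; intros k Hk. unfold J, len.
      rewrite (concat_upto_nth ls' (S k) (S N) k) by (auto; lia). reflexivity.
    + eapply Rle_trans; [apply sum_nth_le_total, Hwf|].
      apply Rle_trans with (c * sum_f_R0 (fun i => (/ 2) ^ (K + i)) N).
      * clear J. induction N as [|N IH].
        -- cbn [concat_upto sum_f_R0 app]. rewrite ET. apply H.
        -- cbn [concat_upto] in IH |- *. rewrite total_app. cbn [sum_f_R0].
           rewrite Rmult_plus_distr_l, ET. apply Rplus_le_compat; [exact IH|apply H].
      * assert (Hc : 0 <= c).
        { destruct (H O) as [W T]; pose proof (total_ge0 _ W); simpl in T; lra. }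
        pose proof (sum_half_pow K N) as S. apply Rmult_le_compat_l with (1 := Hc) in S.
        specialize (HK K (le_n K)). lra.
  - intros t Ht. destruct (Ht K) as (k & Hk & I & HI & HtI).
    destruct (In_nth _ _ (0, 0) HI) as (j & Hj & Ej).
    set (i := (k - K)%nat).
    assert (Hin : In I (concat_upto ls' (S i))).
    { simpl; apply in_or_app; right; right. replace (K + i)%nat with k by (unfold i; lia). exact HI. }
    destruct (In_nth _ _ (0, 0) Hin) as (m & Hm & Em).
    exists m. unfold J.
    replace (nth m (concat_upto ls' (S m)) (0, 0)) with I; auto. rewrite <- Em.
    destruct (le_lt_dec m i) as [L|L].
    + apply concat_upto_nth; auto; lia.
    + clear - Hl Hm L. assert (E : forall n n' k, (k < length (concat_upto ls' n))%nat -> (n <= n')%nat ->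
        nth k (concat_upto ls' n') (0, 0) = nth k (concat_upto ls' n) (0, 0)).
      { intros n n' r Hr Hn; induction Hn as [|n' Hn IH]; auto. simpl; rewrite app_nth1; auto.
        clear IH; induction Hn as [|n' Hn IH]; auto. simpl; rewrite length_app; lia. }
      symmetry; apply E; auto; lia.
Qed.

(* The indices [j] from which some block of increments of [H] has average at least [mu].
   Scanning from the left and jumping over such a block whenever one starts, every bad index is
   met or jumped over. *)
Definition heavy (H : nat -> R) (mu : R) (N j : nat) : Prop :=
  exists k, (1 <= k)%nat /\ (j + k <= N)%nat /\ mu * INR k <= H (j + k)%nat - H j.

(** A discrete weak type (1,1) bound: the blocks jumped over are disjoint and each listed index
    costs an increment of at least mu. The variable n is fuel bounding N - j. *)
Lemma greedy_cover (H : nat -> R) mu N :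
  (forall j, (j < N)%nat -> H j <= H (S j)) ->
  forall n j, (N - j <= n)%nat -> (j <= N)%nat ->
  exists l, (forall i, (j <= i)%nat -> (i < N)%nat -> heavy H mu N i -> In i l) /\
            INR (length l) * mu <= H N - H j.
Proof.
  intros Hmono; induction n as [|n IH]; intros j Hn Hj.
  - replace j with N by lia. exists nil; split; [intros; lia|simpl; lra].
  - destruct (Nat.eq_dec j N) as [->|Hne]; [exists nil; split; [intros; lia|simpl; lra]|].
    destruct (classic (heavy H mu N j)) as [(k & Hk & HkN & Hmu)|Hnb].
    + destruct (IH (j + k)%nat) as (l & Hl & Hlen); try lia.
      exists (seq j k ++ l); split.
      * intros i Hi HiN Hb. apply in_or_app. destruct (le_lt_dec (j + k) i); [right; auto|].
        left; apply in_seq; lia.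
      * rewrite length_app, length_seq, plus_INR. lra.
    + destruct (IH (S j)) as (l & Hl & Hlen); try lia. exists l; split.
      * intros i Hi HiN Hb. apply Hl; auto. destruct (Nat.eq_dec i j) as [->|]; [contradiction|lia].
      * specialize (Hmono j ltac:(lia)). lra.
Qed.

Lemma grid_cell x0 w N y : 0 < w -> (1 <= N)%nat -> x0 <= y <= x0 + INR N * w ->
  exists j, (j < N)%nat /\ x0 + INR j * w <= y <= x0 + INR (S j) * w.
Proof.
  intros Hw HN; induction HN as [|N HN IH]; intros Hy.
  - exists O; split; [lia|]. simpl in *; lra.
  - destruct (Rle_lt_dec y (x0 + INR N * w)) as [L|L].
    + destruct IH as (j & Hj & Hy'); [lra|]. exists j; split; auto.
    + exists N; split; [lia|]. lra.
Qed.

(** * A maximal inequality for a continuous nonnegative density *)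

Section Engine.
Variables (v G : R -> R).
Hypothesis HG : forall x, is_derive G x (v x).
Hypothesis Hc : forall x, continuity_pt v x.
Hypothesis Hv : forall x, 0 <= v x.

Lemma increment_le a b B : a <= b -> (forall x, a <= x <= b -> v x <= B) -> G b - G a <= B * (b - a).
Proof.
  intros Hab H. destruct (Req_dec a b) as [->|Hne]; [lra|].
  destruct (MVT_cor2 G v a b) as (c & E & Hcc); [lra|intros; now apply is_derive_Reals|].
  rewrite E; apply Rmult_le_compat_r; [lra|apply H; lra].
Qed.

Lemma increment_ge a b B : a <= b -> (forall x, a <= x <= b -> B <= v x) -> B * (b - a) <= G b - G a.
Proof.
  intros Hab H. destruct (Req_dec a b) as [->|Hne]; [lra|].
  destruct (MVT_cor2 G v a b) as (c & E & Hcc); [lra|intros; now apply is_derive_Reals|].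
  rewrite E; apply Rmult_le_compat_r; [lra|apply H; lra].
Qed.

Lemma primitive_mono a b : a <= b -> G a <= G b.
Proof. intros H; pose proof (increment_ge a b 0 H ltac:(auto)). lra. Qed.

(** Discretize on a grid of mesh w and apply [greedy_cover]. Each heavy index costs lam w / 3 and
    contributes an interval of length 3 w, whence the factor 9. *)
Lemma one_sided_cover lam : 0 < lam ->
  exists l, wf l /\ total l <= 9 * (G (3 * PI) - G (- PI)) / lam /\
    forall t, 0 <= t <= 2 * PI -> ~ covered l t ->
    forall s, 0 <= s <= PI -> G (t + s) - G t <= lam * s.
Proof.
  intros Hlam. pose proof PI_RGT_0 as HPI.
  assert (Hl3 : 0 < lam / 3) by lra.
  (* Uniform continuity up to lam/3 handles the increments s < w, which the grid does not
     resolve. *)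
  destruct (@Heine_cor2 v (- PI) (3 * PI) (fun x _ => Hc x) (mkposreal _ Hl3)) as [[d Hd] Hunif].
  simpl in Hunif.
  destruct (archimed_cor1 (d / (8 * PI))) as (N & HN & HN0); [apply Rdiv_lt_0_compat; lra|].
  assert (HNp : 0 < INR N) by now apply lt_0_INR.
  set (w := 4 * PI / INR N).
  assert (Hw : 0 < w) by (apply Rdiv_lt_0_compat; lra).
  assert (Hwd : 2 * w < d).
  { unfold w, Rdiv. apply Rmult_lt_compat_r with (r := 8 * PI) in HN; [|lra].
    unfold Rdiv in HN; rewrite Rmult_assoc, Rinv_l in HN by lra. lra. }
  assert (HNw : INR N * w = 4 * PI) by (unfold w; field; lra).
  set (x := fun j => - PI + INR j * w).
  (* The factor 1/3 pays for rounding: if s >= w, the grid interval around [t, t + s] has length at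
     most s + 2 w <= 3 s. *)
  set (mu := lam * w / 3).
  assert (Hmu : 0 < mu) by (unfold mu; assert (0 < lam * w) by (apply Rmult_lt_0_compat; lra); lra).
  (* Each listed cell is widened by w on both sides, so that the open interval contains the closed
     cell. *)
  destruct (greedy_cover (fun j => G (x j)) mu N) with (n := N) (j := O) as (l & Hl & Hlen); try lia.
  { intros j Hj; apply primitive_mono; unfold x; rewrite S_INR; lra. }
  exists (map (fun j => (x j - w, x j + 2 * w)) l). split; [|split].
  - apply Forall_map, Forall_forall; intros j _; simpl; lra.
  - assert (E : total (map (fun j => (x j - w, x j + 2 * w)) l) = 3 * w * INR (length l)).
    { clear. induction l as [|j l IH]; [simpl; ring|].
      cbn [map total fold_right length]. fold (total (map (fun j => (x j - w, x j + 2 * w)) l)).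
      rewrite IH, S_INR. unfold len; simpl; ring. }
    rewrite E. replace (x N) with (3 * PI) in Hlen by (unfold x; lra).
    replace (x O) with (- PI) in Hlen by (unfold x; simpl; lra).
    apply Rmult_le_reg_r with lam; auto. unfold Rdiv; rewrite (Rmult_assoc _ (/ lam)), Rinv_l by lra.
    unfold mu in Hlen. lra.
  - intros t Ht Hnc s Hs.
    destruct (grid_cell (- PI) w N t Hw) as (j & Hj & Hjt); [lia|lra|]. fold (x j) (x (S j)) in Hjt.
    assert (ES : forall i, x (S i) = x i + w) by (intros; unfold x; rewrite S_INR; ring).
    assert (Hnb : ~ heavy (fun j => G (x j)) mu N j).
    { intros Hb; apply Hnc. exists (x j - w, x j + 2 * w); split.
      - apply (in_map (fun j => (x j - w, x j + 2 * w))). apply Hl; auto; lia.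
      - rewrite ES in Hjt; simpl; lra. }
    assert (Hlight : forall k, (1 <= k)%nat -> (j + k <= N)%nat -> G (x (j + k)%nat) - G (x j) < mu * INR k).
    { intros k H1 H2; apply Rnot_le_lt; intros H3; apply Hnb; exists k; auto. }
    assert (Hxr : forall i, (i <= N)%nat -> - PI <= x i <= 3 * PI).
    { intros i Hi; unfold x; apply le_INR in Hi. pose proof (pos_INR i).
      apply Rmult_le_compat_r with (r := w) in Hi; [|lra].
      assert (0 <= INR i * w) by (apply Rmult_le_pos; lra). lra. }
    rewrite ES in Hjt. pose proof (Hxr j ltac:(lia)) as Hxj.
    destruct (Rle_lt_dec w s) as [Hsw|Hsw].
    + destruct (grid_cell (- PI) w N (t + s) Hw) as (i & Hi & Hit); [lia|lra|].
      fold (x i) (x (S i)) in Hit.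
      assert (Hji : (j <= i)%nat).
      { apply Nat.nlt_ge; intros L. apply le_INR in L. unfold x in Hit, Hjt.
        apply Rmult_le_compat_r with (r := w) in L; lra. }
      specialize (Hlight (S i - j)%nat ltac:(lia) ltac:(lia)).
      replace (j + (S i - j))%nat with (S i) in Hlight by lia.
      rewrite minus_INR in Hlight by lia.
      assert (E : mu * (INR (S i) - INR j) = lam / 3 * (x (S i) - x j)) by (unfold mu, x; field).
      rewrite E in Hlight.
      pose proof (primitive_mono (t + s) (x (S i)) ltac:(lra)).
      pose proof (primitive_mono (x j) t ltac:(lra)).
      rewrite ES in Hlight, H, Hit.
      assert (lam / 3 * (x i + w - x j) <= lam / 3 * (3 * s)) by (apply Rmult_le_compat_l; lra).
      lra.
    (* Otherwise v would be at least lam/3 on the whole cell, and the single cell would already be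
       heavy. *)
    + assert (Hvj : v (x j) <= 2 * lam / 3).
      { apply Rnot_lt_le; intros Hgt. specialize (Hlight 1%nat ltac:(lia) ltac:(lia)).
        rewrite Nat.add_1_r in Hlight.
        assert (lam / 3 * (x (S j) - x j) <= G (x (S j)) - G (x j)).
        { apply increment_ge; [rewrite ES; lra|]. intros y Hy. rewrite ES in Hy.
          pose proof (Hxr (S j) ltac:(lia)) as Hxs; rewrite ES in Hxs.
          pose proof (Hunif y (x j) ltac:(lra) ltac:(lra)
            ltac:(rewrite Rabs_pos_eq; lra)) as D. apply Rabs_def2 in D. lra. }
        rewrite ES in H. rewrite ES in Hlight. unfold mu in Hlight. simpl in Hlight. lra. }
      replace (lam * s) with (lam * (t + s - t)) by ring. apply increment_le; [lra|].
      intros y Hy. pose proof (Hunif y (x j) ltac:(lra) ltac:(lra)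
            ltac:(rewrite Rabs_pos_eq; lra)) as D. apply Rabs_def2 in D. lra.
Qed.
End Engine.

(** The left-hand increments come from the reflection x to 2 pi - x, which preserves both [0, 2 pi]
    and [-pi, 3 pi]; the two covers give 18 = 9 + 9. *)
Lemma maximal_cover (v G : R -> R) lam :
  (forall x, is_derive G x (v x)) -> (forall x, continuity_pt v x) -> (forall x, 0 <= v x) ->
  0 < lam ->
  exists l, wf l /\ total l <= 18 * (G (3 * PI) - G (- PI)) / lam /\
    forall t, 0 <= t <= 2 * PI -> ~ covered l t ->
    forall s, 0 <= s <= PI -> G (t + s) - G (t - s) <= 2 * lam * s.
Proof.
  intros HG Hc Hv Hlam.
  destruct (one_sided_cover v G HG Hc Hv lam Hlam) as (l1 & W1 & T1 & H1).
  destruct (one_sided_cover (fun x => v (2 * PI - x)) (fun x => - G (2 * PI - x)))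
    with (lam := lam) as (l2 & W2 & T2 & H2); auto.
  { intros x. apply is_derive_Reals.
    replace (v (2 * PI - x)) with (- (v (2 * PI - x) * (0 - 1))) by ring.
    apply (derivable_pt_lim_opp (fun y => G (2 * PI - y))).
    apply (derivable_pt_lim_comp (fun y => 2 * PI - y) G).
    - apply (derivable_pt_lim_minus (fun _ => 2 * PI) (fun y => y));
        [apply derivable_pt_lim_const|apply derivable_pt_lim_id].
    - apply is_derive_Reals, HG. }
  { intros x. apply (continuity_pt_comp (fun y => 2 * PI - y) v); auto.
    apply (continuity_pt_minus (fun _ => 2 * PI) (fun y => y));
      [apply continuity_pt_const; intros ? ?; reflexivity|apply continuity_pt_id]. }
  replace (2 * PI - 3 * PI) with (- PI) in T2 by ring.
  replace (2 * PI - - PI) with (3 * PI) in T2 by ring.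
  set (l2' := map (fun I => (2 * PI - snd I, 2 * PI - fst I)) l2).
  exists (l1 ++ l2'). split; [|split].
  - apply Forall_app; split; auto. apply Forall_map. eapply Forall_impl; [|exact W2].
    intros I HI; simpl; lra.
  - rewrite total_app. assert (E : total l2' = total l2).
    { unfold l2'; clear; induction l2 as [|I l IH]; simpl; auto. rewrite IH. unfold len; simpl; ring. }
    rewrite E. lra.
  - intros t Ht Hn s Hs. rewrite covered_app in Hn.
    specialize (H1 t Ht ltac:(tauto) s Hs).
    specialize (H2 (2 * PI - t) ltac:(lra)). cbv beta in H2.
    assert (Hn2 : ~ covered l2 (2 * PI - t)).
    { intros (I & HI & HtI); apply Hn; right. exists (2 * PI - snd I, 2 * PI - fst I); split.
      - apply (in_map (fun I => (2 * PI - snd I, 2 * PI - fst I))); auto.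
      - simpl; lra. }
    specialize (H2 Hn2 s Hs).
    replace (2 * PI - (2 * PI - t + s)) with (t - s) in H2 by ring.
    replace (2 * PI - (2 * PI - t)) with t in H2 by ring. lra.
Qed.

(** At a point of continuity the symmetric averages tend to the value. *)
Lemma density_le (v G : R -> R) lam t :
  (forall x, is_derive G x (v x)) -> (forall x, continuity_pt v x) ->
  (forall s, 0 <= s <= PI -> G (t + s) - G (t - s) <= 2 * lam * s) -> v t <= lam.
Proof.
  intros HG Hc H. apply Rnot_lt_le; intros Hgt.
  destruct (Hc t (v t - lam) ltac:(lra)) as (d & Hd & Hcont).
  set (s := Rmin (d / 2) PI).
  pose proof PI_RGT_0.
  assert (Hs : 0 < s /\ s <= d / 2 /\ s <= PI).
  { unfold s; split; [apply Rmin_pos; lra|split; [apply Rmin_l|apply Rmin_r]]. }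
  destruct (MVT_cor2 G v (t - s) (t + s)) as (c & E & Hcc);
    [lra|intros; now apply is_derive_Reals|].
  specialize (H s ltac:(lra)). rewrite E in H.
  assert (Hvc : lam < v c).
  { destruct (Req_dec c t) as [->|Hne]; auto.
    assert (D : Rabs (v c - v t) < v t - lam).
    { apply (Hcont c). split; [split; [exact I|auto]|]. apply Rabs_def1; simpl; lra. }
    apply Rabs_def2 in D; lra. }
  assert (lam * (2 * s) < v c * (2 * s)) by (apply Rmult_lt_compat_r; lra). lra.
Qed.

(** * Trigonometric polynomials and the Poisson kernel *)

Definition cis (t : R) : C := (cos t, sin t).

Fixpoint psum (N : nat) (a : fn) (z : C) : C :=
  match N with O => C0 | S n => Cadd (psum n a z) (Cmul (a n) (Cpow z n)) end.

Lemma Cpow_polar r t n : Cpow (r * cos t, r * sin t) n = (r ^ n * cos (INR n * t), r ^ n * sin (INR n * t)).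
Proof.
  induction n as [|n IH]; [C_solve; rewrite Rmult_0_l, ?cos_0, ?sin_0; ring|].
  cbn [Cpow]; rewrite IH, S_INR, Rmult_plus_distr_r, Rmult_1_l, cos_plus, sin_plus.
  C_solve.
Qed.

Lemma Cpow_cis t n : Cpow (cis t) n = cis (INR n * t).
Proof.
  replace (cis t) with (1 * cos t, 1 * sin t) by (unfold cis; f_equal; ring).
  rewrite Cpow_polar, pow1; unfold cis; f_equal; ring.
Qed.

Lemma psum_ex_derive N a t :
  ex_derive (fun x => fst (psum N a (cis x))) t /\ ex_derive (fun x => snd (psum N a (cis x))) t.
Proof.
  induction N as [|N [H1 H2]]; simpl; [split; apply ex_derive_const|].
  split; apply (@ex_derive_plus R_AbsRing R_NormedModule); auto.
  - apply ex_derive_ext with (fun x => fst (a N) * cos (INR N * x) - snd (a N) * sin (INR N * x));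
      [intros x; now rewrite Cpow_cis|auto_derive; auto].
  - apply ex_derive_ext with (fun x => fst (a N) * sin (INR N * x) + snd (a N) * cos (INR N * x));
      [intros x; now rewrite Cpow_cis|auto_derive; auto].
Qed.

Definition density N a (t : R) : R := Cnorm2 (psum N a (cis t)).

Lemma density_ex_derive N a t : ex_derive (density N a) t.
Proof.
  destruct (psum_ex_derive N a t) as [H1 H2]. unfold density, Cnorm2.
  apply (@ex_derive_plus R_AbsRing R_NormedModule); now apply ex_derive_mult.
Qed.

Lemma density_continuous N a t : continuous (density N a) t.
Proof. apply (@ex_derive_continuous R_AbsRing R_NormedModule), density_ex_derive. Qed.

Lemma density_continuity N a t : continuity_pt (density N a) t.
Proof. apply continuity_pt_filterlim, density_continuous. Qed.

Lemma cos_sin_period (m : Z) :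
  cos (IZR m * (3 * PI)) = cos (IZR m * - PI) /\ sin (IZR m * (3 * PI)) = sin (IZR m * - PI).
Proof.
  assert (H : sin (IZR (2 * m) * PI) = 0) by (apply sin_eq_0_1; eauto).
  split; apply Rminus_diag_uniq.
  - rewrite form2. replace ((IZR m * (3 * PI) - IZR m * - PI) / 2) with (IZR (2 * m) * PI)
      by (rewrite mult_IZR; field). rewrite H; ring.
  - rewrite form4. replace ((IZR m * (3 * PI) - IZR m * - PI) / 2) with (IZR (2 * m) * PI)
      by (rewrite mult_IZR; field). rewrite H; ring.
Qed.

(** All frequencies of the cross term are k - n with k < m <= n, hence nonzero, so it has a periodic
    primitive. *)
Lemma cross_primitive c n a m : (m <= n)%nat ->
  exists B, (forall x, is_derive B x (2 * fst (Cmul (Cmul c (cis (- (INR n * x)))) (psum m a (cis x))))) /\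
    B (3 * PI) = B (- PI).
Proof.
  induction m as [|m IH]; intros Hm.
  - exists (fun _ => 0); split; auto. intros x; simpl.
    replace (2 * _) with 0 by ring. apply (@is_derive_const R_AbsRing R_NormedModule).
  - destruct IH as (B & HB & EB); [lia|].
    set (e := Cmul c (a m)). set (d := (Z.of_nat m - Z.of_nat n)%Z).
    assert (Hd : IZR d <> 0) by (apply not_0_IZR; unfold d; lia).
    assert (Ed : IZR d = INR m - INR n) by (unfold d; rewrite minus_IZR, !INR_IZR_INZ; ring).
    exists (fun x => B x + 2 * (fst e * sin (IZR d * x) + snd e * cos (IZR d * x)) / IZR d).
    split.
    + intros x. evar_last.
      * apply (@is_derive_plus R_AbsRing R_NormedModule); [apply HB|].
        auto_derive; [auto|reflexivity].
      * unfold plus; cbn [psum]; simpl. rewrite Cpow_cis.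
        replace (IZR d * x) with (INR m * x - INR n * x) by (rewrite Ed; ring).
        rewrite cos_minus, sin_minus. unfold cis, e; cbn [fst snd Cmul Cadd].
        rewrite cos_neg, sin_neg. field; auto.
    + destruct (cos_sin_period d) as [E1 E2]. rewrite EB, E1, E2. reflexivity.
Qed.

(** Parseval's identity over a window of length 4 pi, with the primitive built one coefficient at a
    time. *)
Lemma density_primitive N a :
  exists G, (forall x, is_derive G x (density N a x)) /\
    G (3 * PI) - G (- PI) = 4 * PI * N2 (trunc N a).
Proof.
  induction N as [|N (G & HG & EG)].
  - exists (fun _ => 0); split.
    + intros x; unfold density, Cnorm2; simpl. replace (_ + _) with 0 by ring.
      apply (@is_derive_const R_AbsRing R_NormedModule).
    + replace (trunc 0 a) with fzero by reflexivity. rewrite N2_fzero; ring.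
  - destruct (cross_primitive (Cconj (a N)) N a N (le_n N)) as (B & HB & EB).
    exists (fun x => (G x + B x) + Cnorm2 (a N) * x). split.
    + intros x. evar_last.
      * apply (@is_derive_plus R_AbsRing R_NormedModule);
          [apply (@is_derive_plus R_AbsRing R_NormedModule); [apply HG|apply HB]|].
        auto_derive; [auto|reflexivity].
      * unfold plus; simpl. unfold density; cbn [psum]. rewrite Cpow_cis. unfold cis.
        rewrite cos_neg, sin_neg.
        pose proof (sin2_cos2 (INR N * x)) as E; unfold Rsqr in E.
        set (u := cos (INR N * x)) in *. set (w := sin (INR N * x)) in *.
        assert (E' : Cnorm2 (a N) = Cnorm2 (a N) * (w * w + u * u)) by (rewrite E; ring).
        destruct (psum N a (cos x, sin x)) as [X Y], (a N) as [b1 b2].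
        unfold Cnorm2, Cadd, Cmul, Cconj in *; simpl in *. lra.
    + assert (E : N2 (trunc (S N) a) = N2 (trunc N a) + Cnorm2 (a N)).
      { destruct N as [|n].
        - replace (trunc 0 a) with fzero by reflexivity. rewrite N2_fzero, N2_trunc; simpl; ring.
        - now rewrite !N2_trunc. }
      rewrite E, EB. replace (G (3 * PI)) with (4 * PI * N2 (trunc N a) + G (- PI)) by lra. ring.
Qed.

(** * The Poisson kernel: cosine moments and radial bounds *)

Definition poisson (r s : R) : R := (1 - r ^ 2) / (1 - 2 * r * cos s + r ^ 2).

Section Poisson.
Variable r : R.
Hypothesis Hr : 0 < r < 1.

Lemma poisson_den s : 0 < 1 - 2 * r * cos s + r ^ 2.
Proof.
  pose proof (COS_bound s) as [H1 H2].
  assert (0 <= r * (1 - cos s)) by (apply Rmult_le_pos; lra).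
  assert (0 < (1 - r) * (1 - r)) by (apply Rmult_lt_0_compat; lra). lra.
Qed.

Lemma poisson_num : 0 < 1 - r ^ 2.
Proof. assert (0 < (1 - r) * (1 + r)) by (apply Rmult_lt_0_compat; lra). lra. Qed.

Lemma poisson_pos s : 0 < poisson r s.
Proof. apply Rdiv_lt_0_compat; [apply poisson_num|apply poisson_den]. Qed.

Lemma poisson_derive s :
  is_derive (poisson r) s (- ((1 - r ^ 2) * (2 * r * sin s) / (1 - 2 * r * cos s + r ^ 2) ^ 2)).
Proof.
  pose proof (poisson_den s). unfold poisson. auto_derive; [lra|]. field; lra.
Qed.

Lemma poisson_continuous s : continuous (poisson r) s.
Proof.
  apply (@ex_derive_continuous R_AbsRing R_NormedModule). eexists; apply poisson_derive.
Qed.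

Lemma ex_RInt_poisson_mult f a b : (forall x, continuous f x) -> ex_RInt (fun s => poisson r s * f s) a b.
Proof.
  intros Hf; apply (@ex_RInt_continuous R_CompleteNormedModule); intros z _.
  apply (@continuous_mult R_UniformSpace R_AbsRing); [apply poisson_continuous|apply Hf].
Qed.

(* Integration by parts against the decreasing weight [poisson r]. *)
Lemma poisson_weight (W wd : R -> R) :
  (forall x, is_derive W x (wd x)) -> (forall x, continuous wd x) ->
  W 0 = 0 -> (forall s, 0 <= s <= PI -> 0 <= W s) ->
  0 <= RInt (fun s => poisson r s * wd s) 0 PI.
Proof.
  intros HW Hc H0 Hpos. pose proof PI_RGT_0 as HPI.
  set (F := fun x => RInt (fun s => poisson r s * wd s) 0 x).
  assert (HF : forall x, is_derive F x (poisson r x * wd x)).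
  { intros x. apply (is_derive_RInt (fun s => poisson r s * wd s) F 0).
    - apply filter_forall; intros y. apply (@RInt_correct R_CompleteNormedModule).
      now apply ex_RInt_poisson_mult.
    - apply (@continuous_mult R_UniformSpace R_AbsRing); [apply poisson_continuous|apply Hc]. }
  set (D := fun s => (1 - r ^ 2) * (2 * r * sin s) / (1 - 2 * r * cos s + r ^ 2) ^ 2).
  set (J := fun x => F x - poisson r x * W x).
  assert (HJ : forall x, is_derive J x (D x * W x)).
  { intros x. unfold J. evar_last.
    - apply (@is_derive_minus R_AbsRing R_NormedModule); [apply HF|].
      apply (is_derive_mult (poisson r) W); [apply poisson_derive|apply HW].
    - unfold minus, plus, opp, D; simpl; ring. }
  (* [D] is minus the derivative of the kernel, nonnegative on [0, pi], so [J] increases from 0 to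
     pi; the boundary term at pi is nonnegative too. *)
  destruct (MVT_cor2 J (fun x => D x * W x) 0 PI) as (c & E & Hcc);
    [lra|intros; now apply is_derive_Reals|].
  assert (0 <= D c * W c).
  { apply Rmult_le_pos; [|apply Hpos; lra]. unfold D.
    apply Rmult_le_pos; [|left; apply Rinv_0_lt_compat, pow_lt, poisson_den].
    pose proof poisson_num. apply Rmult_le_pos; [lra|].
    pose proof (sin_ge_0 c ltac:(lra) ltac:(lra)). apply Rmult_le_pos; lra. }
  assert (HJ0 : 0 <= J PI - J 0) by (rewrite E; apply Rmult_le_pos; lra).
  assert (EJ : J 0 = 0) by (unfold J, F; rewrite RInt_point, H0; unfold zero; simpl; ring).
  assert (HWP : 0 <= poisson r PI * W PI).
  { apply Rmult_le_pos; [left; apply poisson_pos|apply Hpos; lra]. }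
  rewrite EJ in HJ0. change (0 <= F PI). unfold J in HJ0. lra.
Qed.

Lemma continuous_cos_mult m x : continuous (fun s => cos (INR m * s)) x.
Proof.
  apply (@ex_derive_continuous R_AbsRing R_NormedModule); auto_derive; auto.
Qed.

Let I (m : nat) : R := RInt (fun s => poisson r s * cos (INR m * s)) 0 PI.

Let I_correct m : is_RInt (fun s => poisson r s * cos (INR m * s)) 0 PI (I m).
Proof.
  apply (@RInt_correct R_CompleteNormedModule), ex_RInt_poisson_mult, continuous_cos_mult.
Qed.

(** Multiply the kernel by its denominator: the integrand becomes (1 - r^2) cos ((m+1) s), whose
    integral over [0, pi] is 0. *)
Lemma poisson_cos_recurrence m :
  (1 + r ^ 2) * I (S m) - r * (I (S (S m)) + I m) = 0.
Proof.
  pose proof (I_correct m) as H0; pose proof (I_correct (S m)) as H1;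
  pose proof (I_correct (S (S m))) as H2.
  apply (@is_RInt_scal R_NormedModule _ 0 PI (1 + r ^ 2)) in H1.
  pose proof (@is_RInt_plus R_NormedModule _ _ 0 PI _ _ H2 H0) as H3.
  apply (@is_RInt_scal R_NormedModule _ 0 PI r) in H3.
  pose proof (@is_RInt_minus R_NormedModule _ _ 0 PI _ _ H1 H3) as H4.
  assert (H5 : is_RInt (fun s => (1 - r ^ 2) * cos (INR (S m) * s)) 0 PI
     (minus ((1 - r ^ 2) / INR (S m) * sin (INR (S m) * PI)) ((1 - r ^ 2) / INR (S m) * sin (INR (S m) * 0)))).
  { assert (INR (S m) <> 0) by (apply not_0_INR; lia).
    apply (@is_RInt_derive R_CompleteNormedModule
      (fun s => (1 - r ^ 2) / INR (S m) * sin (INR (S m) * s))).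
    - intros x _. set (n := INR (S m)) in *. auto_derive; auto. field; auto.
    - intros x _. apply (@ex_derive_continuous R_AbsRing R_NormedModule).
      set (n := INR (S m)) in *. auto_derive; auto. }
  apply (is_RInt_ext _ (fun s => (1 - r ^ 2) * cos (INR (S m) * s))) in H4.
  - apply (@is_RInt_unique R_CompleteNormedModule) in H4, H5. rewrite H4 in H5.
    rewrite Rmult_0_r, sin_0, INR_IZR_INZ, (sin_eq_0_1 (IZR _ * PI)) in H5 by eauto.
    unfold minus, plus, opp, scal in H5; simpl in H5; unfold mult in H5; simpl in H5. lra.
  - intros s _. unfold minus, plus, opp, scal; cbn -[INR pow]; unfold mult; cbn -[INR pow].
    replace (INR (S (S m)) * s) with (INR (S m) * s + s) by (rewrite (S_INR (S m)); ring).
    replace (INR m * s) with (INR (S m) * s - s) by (rewrite (S_INR m); ring).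
    rewrite cos_plus, cos_minus. unfold poisson. pose proof (poisson_den s). field. lra.
Qed.

(** The recurrence has the solutions r^m and r^-m. The combination [D] isolates the growing one, D_0
    = r^k D_k, and boundedness of the moments forces it to vanish. *)
Lemma poisson_cos_1 : I 1 = r * I 0.
Proof.
  set (D := fun m => I (S m) - r * I m).
  assert (HD : forall m, D m = r * D (S m)).
  { intros m; unfold D; pose proof (poisson_cos_recurrence m). lra. }
  assert (HDk : forall k, D O = r ^ k * D k).
  { induction k as [|k IH]; [simpl; ring|]. rewrite IH, (HD k); simpl; ring. }
  assert (HI : forall m, Rabs (I m) <= I 0).
  { intros m. pose proof PI_RGT_0. pose proof (I_correct m) as H1. pose proof (I_correct 0) as H0.
    pose proof (@is_RInt_opp R_NormedModule _ _ _ _ H0) as H2.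
    assert (B : forall s, - poisson r s <= poisson r s * cos (INR m * s) <= poisson r s).
    { intros s; pose proof (poisson_pos s). destruct (COS_bound (INR m * s)) as [C1 C2].
      apply Rmult_le_compat_l with (r := poisson r s) in C1, C2; lra. }
    assert (E : forall s, poisson r s * cos (INR 0 * s) = poisson r s)
      by (intros; simpl; rewrite Rmult_0_l, cos_0; ring).
    apply Rabs_le; split.
    - apply (is_RInt_le _ _ 0 PI _ _ ltac:(lra) H2 H1). intros s _.
      unfold opp; simpl. rewrite Rmult_0_l, cos_0. pose proof (B s); lra.
    - apply (is_RInt_le _ _ 0 PI _ _ ltac:(lra) H1 H0). intros s _. rewrite E; apply B. }
  assert (HDb : forall m, Rabs (D m) <= 2 * I 0).
  { intros m. unfold D. pose proof (HI m) as A1; pose proof (HI (S m)) as A2.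
    eapply Rle_trans; [apply Rabs_triang|]. rewrite Rabs_Ropp, Rabs_mult, (Rabs_pos_eq r) by lra.
    assert (r * Rabs (I m) <= 1 * Rabs (I m)) by (apply Rmult_le_compat_r; [apply Rabs_pos|lra]). lra. }
  assert (Z : D O = 0).
  { apply NNPP; intros HZ. apply Rabs_pos_lt in HZ.
    pose proof (HDb O) as B0.
    destruct (pow_lt_1_zero r ltac:(rewrite Rabs_pos_eq; lra) (Rabs (D O) / (2 * I 0))) as [N HN].
    { apply Rdiv_lt_0_compat; lra. }
    specialize (HN N (le_n N)). pose proof (HDb N) as BN. rewrite (HDk N), Rabs_mult in HZ, B0, HN.
    apply Rmult_lt_compat_r with (r := 2 * I 0) in HN; [|lra].
    unfold Rdiv in HN; rewrite Rmult_assoc, Rinv_l, Rmult_1_r in HN by lra.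
    assert (Rabs (r ^ N) * Rabs (D N) <= Rabs (r ^ N) * (2 * I 0))
      by (apply Rmult_le_compat_l; [apply Rabs_pos|auto]). lra. }
  unfold D in Z; lra.
Qed.

Lemma poisson_cos_0 : I 0 = PI.
Proof.
  pose proof (I_correct 0) as H0; pose proof (I_correct 1) as H1.
  apply (@is_RInt_scal R_NormedModule _ 0 PI (1 + r ^ 2)) in H0.
  apply (@is_RInt_scal R_NormedModule _ 0 PI (2 * r)) in H1.
  pose proof (@is_RInt_minus R_NormedModule _ _ 0 PI _ _ H0 H1) as H4.
  apply (is_RInt_ext _ (fun s => 1 - r ^ 2)) in H4.
  - pose proof (@is_RInt_const R_NormedModule 0 PI (1 - r ^ 2)) as H5.
    apply (@is_RInt_unique R_CompleteNormedModule) in H4, H5. rewrite H4 in H5. rewrite poisson_cos_1 in H5.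
    unfold minus, plus, opp, scal in H5; simpl in H5; unfold mult in H5; simpl in H5.
    pose proof poisson_num. apply Rmult_eq_reg_l with (1 - r ^ 2); lra.
  - intros s _. unfold minus, plus, opp, scal; simpl; unfold mult; simpl.
    rewrite Rmult_0_l, Rmult_1_l, cos_0. unfold poisson. pose proof (poisson_den s). field. lra.
Qed.

Lemma poisson_cos m : is_RInt (fun s => poisson r s * cos (INR m * s)) 0 PI (PI * r ^ m).
Proof.
  cut (I m = PI * r ^ m /\ I (S m) = PI * r ^ S m); [intros [<- _]; apply I_correct|].
  induction m as [|m [IH1 IH2]].
  - rewrite poisson_cos_1, poisson_cos_0; simpl; split; ring.
  - split; auto. pose proof (poisson_cos_recurrence m) as E. rewrite IH1, IH2 in E.
    simpl in *. apply Rmult_eq_reg_l with r; lra.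
Qed.

(** Poisson's formula, symmetrized in s so that only the cosine moments over [0, pi] enter. *)
Lemma poisson_psum c N a t :
  is_RInt (fun s => poisson r s * fst (Cmul c (Cadd (psum N a (cis (t + s))) (psum N a (cis (t - s))))))
    0 PI (2 * PI * fst (Cmul c (psum N a (r * cos t, r * sin t)))).
Proof.
  induction N as [|N IH].
  - simpl. apply is_RInt_ext with (fun _ => 0); [intros; simpl; ring|].
    evar_last; [apply (@is_RInt_const R_NormedModule)|]. unfold scal; simpl; unfold mult; simpl; ring.
  - pose proof (poisson_cos N) as HN.
    apply (@is_RInt_scal R_NormedModule _ 0 PI (2 * fst (Cmul c (Cmul (a N) (cis (INR N * t)))))) in HN.
    pose proof (@is_RInt_plus R_NormedModule _ _ 0 PI _ _ IH HN) as H.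
    evar_last; [eapply is_RInt_ext; [|exact H]|].
    + intros s _. unfold plus, scal; cbn -[INR pow psum]; unfold mult; cbn -[INR pow psum].
      cbn [psum]. rewrite !Cpow_cis.
      replace (INR N * (t + s)) with (INR N * t + INR N * s) by ring.
      replace (INR N * (t - s)) with (INR N * t - INR N * s) by ring. unfold cis.
      cbn -[INR pow psum].
      rewrite !(cos_plus (INR N * t)), !(cos_minus (INR N * t)), !(sin_plus (INR N * t)),
        !(sin_minus (INR N * t)). ring.
    + cbn [psum]. rewrite Cpow_polar. unfold plus, scal; cbn -[INR pow psum]; unfold mult; cbn -[INR pow psum]. ring.
Qed.

(** The kernel decreases on [0, pi], so bounds on all symmetric averages bound the Poisson mean of
    |psum|^2. In place of Jensen's inequality, the mean of |psum - c|^2 is nonnegative, where c is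
    the Poisson mean of psum. *)
Lemma poisson_bound N a lam t G :
  (forall x, is_derive G x (density N a x)) ->
  (forall s, 0 <= s <= PI -> G (t + s) - G (t - s) <= 2 * lam * s) ->
  Cnorm2 (psum N a (r * cos t, r * sin t)) <= lam.
Proof.
  intros HG H. pose proof PI_RGT_0 as HPI.
  set (c := psum N a (r * cos t, r * sin t)).
  set (W := fun s => 2 * lam * s - (G (t + s) - G (t - s))).
  set (wd := fun s => 2 * lam - (density N a (t + s) + density N a (t - s))).
  assert (Hwc : forall x, continuous wd x).
  { intros x; apply (@ex_derive_continuous R_AbsRing R_NormedModule). unfold wd.
    auto_derive. repeat split; auto; apply density_ex_derive. }
  assert (HK : 0 <= RInt (fun s => poisson r s * wd s) 0 PI).
  { apply (poisson_weight W); auto.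
    - intros x; unfold W, wd.
      assert (HG' : forall y, ex_derive G y) by (intros y; eexists; apply HG).
      auto_derive; [repeat split; auto|].
      rewrite !(is_derive_unique _ _ _ (HG _)). unfold Rminus; ring.
    - unfold W. rewrite Rplus_0_r, Rminus_0_r; ring.
    - intros s Hs; unfold W. specialize (H s Hs); lra. }
  assert (H1 : is_RInt (fun s => poisson r s * wd s) 0 PI (RInt (fun s => poisson r s * wd s) 0 PI)).
  { apply (@RInt_correct R_CompleteNormedModule). now apply ex_RInt_poisson_mult. }
  pose proof (poisson_psum (Cconj c) N a t) as H2. fold c in H2.
  pose proof (poisson_cos 0) as H3.
  apply (@is_RInt_scal R_NormedModule _ 0 PI 2) in H2.
  apply (@is_RInt_scal R_NormedModule _ 0 PI (2 * lam + 2 * Cnorm2 c)) in H3.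
  pose proof (@is_RInt_minus R_NormedModule _ _ 0 PI _ _ H3 H2) as H4.
  assert (HL := is_RInt_le _ _ 0 PI _ _ ltac:(lra) H1 H4).
  assert (E : fst (Cmul (Cconj c) c) = Cnorm2 c) by (unfold Cnorm2; simpl; ring).
  rewrite E in HL.
  unfold minus, plus, opp, scal in HL; simpl in HL; unfold mult in HL; simpl in HL.
  assert (HLE : RInt (fun s => poisson r s * wd s) 0 PI <=
     (2 * lam + 2 * Cnorm2 c) * (PI * 1) + - (2 * (2 * PI * Cnorm2 c))).
  { apply HL. intros s _. unfold wd. rewrite Rmult_0_l, cos_0.
    pose proof (poisson_pos s) as HP.
    unfold density. destruct (psum N a (cis (t + s))) as [x1 y1], (psum N a (cis (t - s))) as [x2 y2].
    destruct c as [c1 c2]. unfold Cnorm2; simpl.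
    assert (Q : 0 <= poisson r s * ((x1 - c1) ^ 2 + (y1 - c2) ^ 2 + (x2 - c1) ^ 2 + (y2 - c2) ^ 2)).
    { apply Rmult_le_pos; [lra|]. repeat apply Rplus_le_le_0_compat; apply pow2_ge_0. }
    lra. }
  apply Rmult_le_reg_l with (2 * PI); lra.
Qed.
End Poisson.

(** * Evaluation in the disk *)

Definition Cab (z : C) : R := sqrt (Cnorm2 z).

Lemma Cab_ge0 z : 0 <= Cab z.
Proof. apply sqrt_pos. Qed.

Lemma Cab_sqr z : Cab z * Cab z = Cnorm2 z.
Proof. apply sqrt_sqrt, Cnorm2_ge0. Qed.

Lemma Cab_mul z w : Cab (Cmul z w) = Cab z * Cab w.
Proof. unfold Cab; rewrite Cnorm2_mul; apply sqrt_mult; apply Cnorm2_ge0. Qed.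

Lemma Cab_le z B : 0 <= B -> Cnorm2 z <= B * B -> Cab z <= B.
Proof. intros HB H; unfold Cab; rewrite <- (sqrt_square B HB); now apply sqrt_le_1_alt. Qed.

Lemma Cab_add z w : Cab (Cadd z w) <= Cab z + Cab w.
Proof.
  pose proof (Cab_ge0 z); pose proof (Cab_ge0 w). apply Cab_le; [lra|].
  assert (HR : fst z * fst w + snd z * snd w <= Cab z * Cab w).
  { eapply Rle_trans; [apply Rle_abs|].
    unfold Cab; rewrite <- sqrt_mult by apply Cnorm2_ge0. rewrite <- sqrt_Rsqr_abs.
    apply sqrt_le_1_alt. pose proof (pow2_ge_0 (fst z * snd w - snd z * fst w)).
    unfold Cnorm2, Rsqr; lra. }
  replace ((Cab z + Cab w) * (Cab z + Cab w)) with (Cab z * Cab z + Cab w * Cab w + 2 * (Cab z * Cab w))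
    by ring. rewrite !Cab_sqr. unfold Cnorm2, Cadd in *; simpl in *. lra.
Qed.

Lemma Cnorm2_opp z : Cnorm2 (Copp z) = Cnorm2 z.
Proof. unfold Cnorm2, Copp; simpl; ring. Qed.

Lemma Cab_sub_sym z w : Cab (Csub z w) = Cab (Csub w z).
Proof. unfold Cab; f_equal; unfold Cnorm2, Csub, Cadd, Copp; simpl; ring. Qed.

Lemma Cab_sub_triangle x y z : Cab (Csub x z) <= Cab (Csub x y) + Cab (Csub y z).
Proof. replace (Csub x z) with (Cadd (Csub x y) (Csub y z)) by ring. apply Cab_add. Qed.

(** The reproducing kernel of H^2 at z. *)
Definition szego (z : C) : fn := fun n => Cconj (Cpow z n).

Lemma Cnorm2_pow z n : Cnorm2 (Cpow z n) = Cnorm2 z ^ n.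
Proof.
  induction n as [|n IH]; simpl; [unfold Cnorm2; simpl; ring|now rewrite Cnorm2_mul, IH].
Qed.

Lemma szego_norm z : Cnorm2 z < 1 -> has_norm2 (szego z) (/ (1 - Cnorm2 z)).
Proof.
  intros Hz. apply is_series_Reals.
  apply is_series_ext with (fun n => Cnorm2 z ^ n).
  - intros n; unfold szego; now rewrite Cnorm2_conj, Cnorm2_pow.
  - apply is_series_geom. rewrite Rabs_pos_eq; [exact Hz|apply Cnorm2_ge0].
Qed.

Lemma inH2_szego z : Cnorm2 z < 1 -> inH2 (szego z).
Proof. intros Hz; eexists; now apply szego_norm. Qed.

Definition ev (a : fn) (z : C) : C := ip a (szego z).

Lemma ps_eval_ev a z : inH2 a -> Cnorm2 z < 1 -> ps_eval a z (ev a z).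
Proof.
  intros Ha Hz. destruct (ip_inner a (szego z) Ha (inH2_szego z Hz)) as [H1 H2].
  unfold ps_eval. replace (fun n => Cmul (a n) (Cpow z n))
    with (fun n => Cmul (a n) (Cconj (szego z n))); [split; assumption|].
  apply functional_extensionality; intros n; unfold szego; now rewrite Cconj_invol.
Qed.

Lemma ev_bound a z : inH2 a -> Cnorm2 z < 1 -> Cnorm2 (ev a z) <= N2 a * / (1 - Cnorm2 z).
Proof.
  intros Ha Hz. rewrite <- (has_norm2_N2 _ _ (szego_norm z Hz)).
  apply cauchy_schwarz; auto using inH2_szego.
Qed.

Lemma ev_hd_tl a z : inH2 a -> Cnorm2 z < 1 ->
  ev a z = Cadd (a O) (Cmul z (ev (tl a) z)).
Proof.
  intros Ha Hz. pose proof (inH2_szego z Hz) as Hk.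
  assert (E : szego z = fadd one (fscal (Cconj z) (shift (szego z)))).
  { apply functional_extensionality; intros [|n]; unfold szego, fadd, fscal; cbn [shift Cpow one].
    - C_solve.
    - rewrite Cconj_mul; ring. }
  assert (E1 : ip one one = C1) by (rewrite ip_self, N2_one; reflexivity).
  assert (Es : forall f, inH2 f -> ev (shift f) z = Cmul z (ev f z)).
  { intros f Hf. unfold ev. rewrite E at 1.
    rewrite ip_add_r, ip_scal_r, ip_shift, ip_shift_one, Cconj_invol by auto with h2. ring. }
  rewrite (hd_tl a) at 1. unfold ev at 1. rewrite ip_add_l, ip_scal_l by auto with h2.
  fold (ev (shift (tl a)) z). rewrite Es by auto with h2. f_equal.
  rewrite E, ip_add_r, ip_scal_r, (ip_sym (shift _) one), ip_shift_one, E1 by auto with h2. C_solve.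
Qed.

Lemma ev_shift a z : inH2 a -> Cnorm2 z < 1 -> ev (shift a) z = Cmul z (ev a z).
Proof.
  intros Ha Hz. rewrite ev_hd_tl by auto with h2. simpl. change (tl (shift a)) with a. ring.
Qed.

Lemma ev_trunc N a z : Cnorm2 z < 1 -> ev (trunc N a) z = psum N a z.
Proof.
  intros Hz. pose proof (inH2_szego z Hz). induction N as [|N IH].
  - replace (trunc 0 a) with (fscal C0 fzero) by (apply functional_extensionality; intros; unfold fscal, fzero, trunc; simpl; ring).
    unfold ev; rewrite ip_scal_l by auto with h2. simpl; ring.
  - cbn [psum]. rewrite <- IH.
    assert (E : ev (fsub (trunc (S N) a) (trunc N a)) z = Cmul (a N) (Cpow z N)).
    { assert (Hm : fsub (trunc (S N) a) (trunc N a) = fscal (a N) (Nat.iter N shift one)).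
      { apply functional_extensionality; intros k; unfold fsub, fscal.
        assert (Hi : forall m j, Nat.iter m shift one j = if (j =? m)%nat then C1 else C0).
        { induction m as [|m IHm]; intros [|j]; simpl; auto. }
        rewrite Hi. destruct (Nat.eqb_spec k N) as [->|Hne].
        - rewrite trunc_lt, trunc_ge by lia. ring.
        - destruct (Nat.lt_ge_cases k N); [rewrite !trunc_lt by lia|rewrite !trunc_ge by lia]; ring. }
      assert (Hm2 : forall m, inH2 (Nat.iter m shift one) /\ ev (Nat.iter m shift one) z = Cpow z m).
      { induction m as [|m [I1 I2]]; simpl; [|split; auto with h2; now rewrite ev_shift, I2].
        split; auto with h2. rewrite ev_hd_tl by auto with h2. change (tl one) with fzero.
        replace fzero with (fscal C0 fzero) by fn_solve.
        unfold ev; rewrite ip_scal_l by auto with h2. simpl; ring. }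
      rewrite Hm. unfold ev; rewrite ip_scal_l; try apply Hm2; auto. fold (ev (Nat.iter N shift one) z).
      now rewrite (proj2 (Hm2 N)). }
    rewrite <- E. unfold ev. rewrite ip_sub_l by auto with h2. ring.
Qed.

(* Testing contractivity on the Szego kernel [1 / (1 - conj z w)]. *)
Lemma contractive_bounded th z : contractive th -> inH2 th -> Cnorm2 z < 1 -> Cnorm2 (ev th z) <= 1.
Proof.
  intros Hth Ht Hz. set (f := szego z). pose proof (inH2_szego z Hz) as Hf. fold f in Hf.
  destruct (Hth f Hf) as [Hg Ng]. set (g := cauchy th f) in *.
  assert (E : g = fadd th (fscal (Cconj z) (shift g))).
  { assert (Ef : f = fadd one (fscal (Cconj z) (shift f))).
    { apply functional_extensionality; intros [|n]; unfold f, szego, fadd, fscal; cbn [shift Cpow one].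
      - C_solve.
      - rewrite Cconj_mul; ring. }
    unfold g at 1; rewrite Ef.
    now rewrite cauchy_add_r, cauchy_scal_r, cauchy_one_r, cauchy_shift_r. }
  (* Evaluating g = th + conj z (z g) at z gives th(z) = (1 - |z|^2) g(z), and g(z) has modulus at
     most 1 / (1 - |z|^2). *)
  assert (Ee : ev th z = Cmul (1 - Cnorm2 z, 0) (ev g z)).
  { assert (Eg : ev g z = Cadd (ev th z) (Cmul (Cconj z) (Cmul z (ev g z)))).
    { rewrite E at 1. unfold ev at 1. rewrite ip_add_l, ip_scal_l by auto with h2.
      fold (ev th z). fold (ev (shift g) z). now rewrite ev_shift. }
    replace (ev th z) with (Csub (ev g z) (Cmul (Cconj z) (Cmul z (ev g z)))) by (rewrite Eg at 1; ring).
    C_solve. }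
  pose proof (ev_bound g z Hg Hz) as B.
  unfold f in Ng; rewrite (has_norm2_N2 _ _ (szego_norm z Hz)) in Ng.
  set (d := 1 - Cnorm2 z) in *. assert (Hd : 0 < d) by (unfold d; lra).
  assert (Hi : 0 < / d) by now apply Rinv_0_lt_compat.
  rewrite Ee, Cnorm2_mul. replace (Cnorm2 (d, 0)) with (d * d) by (unfold Cnorm2; simpl; ring).
  apply Rle_trans with (d * d * (/ d * / d)); [|right; field; lra].
  apply Rmult_le_compat_l; [apply Rmult_le_pos; lra|].
  eapply Rle_trans; [exact B|]. apply Rmult_le_compat_r; lra.
Qed.

Lemma Cnorm2_polar r t : Cnorm2 (r * cos t, r * sin t) = r ^ 2.
Proof.
  unfold Cnorm2; simpl. pose proof (sin2_cos2 t) as E; unfold Rsqr in E.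
  replace (_ + _) with (r * r * (sin t * sin t + cos t * cos t)) by ring. rewrite E; ring.
Qed.

Lemma polar_disk r t : 0 <= r < 1 -> Cnorm2 (r * cos t, r * sin t) < 1.
Proof.
  intros Hr; rewrite Cnorm2_polar. assert (r * r < 1); [|simpl; lra].
  apply Rle_lt_trans with (r * 1); [apply Rmult_le_compat_l; lra|lra].
Qed.

Lemma pow_bernoulli r k : 0 <= r <= 1 -> 1 - INR k * (1 - r) <= r ^ k <= 1.
Proof.
  intros Hr; induction k as [|k IH]; [simpl; lra|]. rewrite S_INR; cbn [pow].
  assert (0 <= r ^ k) by (apply pow_le; lra). split.
  - assert (H1 : r * (1 - INR k * (1 - r)) <= r * r ^ k) by (apply Rmult_le_compat_l; lra).
    pose proof (pos_INR k). pose proof (pow2_ge_0 (1 - r)) as H3.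
    pose proof (Rmult_le_pos _ _ H0 H3). lra.
  - apply Rle_trans with (1 * r ^ k); [apply Rmult_le_compat_r; lra|lra].
Qed.

Lemma psum_radial N a t : exists B, 0 <= B /\ forall r, 0 <= r <= 1 ->
  Cab (Csub (psum N a (r * cos t, r * sin t)) (psum N a (cis t))) <= B * (1 - r).
Proof.
  induction N as [|N (B & HB & H)].
  - exists 0; split; [lra|]. intros r Hr; simpl. apply Cab_le; [lra|]. unfold Cnorm2; simpl; lra.
  - exists (B + Cab (a N) * INR N). pose proof (Cab_ge0 (a N)); pose proof (pos_INR N).
    split; [apply Rplus_le_le_0_compat; auto; now apply Rmult_le_pos|]. intros r Hr. cbn [psum].
    rewrite Cpow_polar, Cpow_cis.
    replace (Csub _ _) with (Cadd (Csub (psum N a (r * cos t, r * sin t)) (psum N a (cis t)))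
      (Cmul (a N) (Cmul (r ^ N - 1, 0) (cis (INR N * t))))).
    2:{ generalize (psum N a (r * cos t, r * sin t)) (psum N a (cis t)); C_solve. }
    eapply Rle_trans; [apply Cab_add|]. rewrite Rmult_plus_distr_r.
    apply Rplus_le_compat; [now apply H|]. rewrite Cab_mul, Rmult_assoc.
    apply Rmult_le_compat_l; auto. rewrite Cab_mul.
    replace (Cab (cis (INR N * t))) with 1.
    2:{ unfold Cab. symmetry. rewrite <- sqrt_1. f_equal. unfold Cnorm2, cis; simpl.
        pose proof (sin2_cos2 (INR N * t)) as E; unfold Rsqr in E; lra. }
    rewrite Rmult_1_r. destruct (pow_bernoulli r N Hr).
    apply Cab_le; [apply Rmult_le_pos; lra|]. unfold Cnorm2; simpl.
    replace ((r ^ N - 1) * (r ^ N - 1) + 0 * 0) with ((1 - r ^ N) * (1 - r ^ N)) by ring.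
    apply Rmult_le_compat; lra.
Qed.

(** * Radial limits *)

(** A weak type bound for the radial maximal function of a polynomial; 72 pi is 18 times the 4 pi
    from Parseval. *)
Lemma radial_maximal N a lam : 0 < lam ->
  exists l, wf l /\ total l <= 72 * PI * N2 (trunc N a) / lam /\
    forall t, 0 <= t <= 2 * PI -> ~ covered l t ->
    forall r, 0 < r < 1 -> Cnorm2 (psum N a (r * cos t, r * sin t)) <= lam.
Proof.
  intros Hlam. destruct (density_primitive N a) as (G & HG & EG).
  destruct (maximal_cover (density N a) G lam) as (l & W & T & H); auto.
  - apply density_continuity.
  - intros; apply Cnorm2_ge0.
  - exists l; split; auto. split.
    + rewrite EG in T. replace (72 * PI * N2 (trunc N a)) with (18 * (4 * PI * N2 (trunc N a))) by ring.
      exact T.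
    + intros t Ht Hn r Hr. apply (poisson_bound r Hr N a lam t G); auto.
Qed.

Section Inner.
Variable th : fn.
Hypothesis Hth : isometric th.

Let Ht : inH2 th.
Proof. pose proof (proj1 (Hth one inH2_one)) as H. now rewrite cauchy_one_r in H. Qed.

Let Nt : N2 th = 1.
Proof. pose proof (proj2 (Hth one inH2_one)) as H. now rewrite cauchy_one_r, N2_one in H. Qed.

Let Hbound z : Cnorm2 z < 1 -> Cnorm2 (ev th z) <= 1.
Proof.
  intros Hz; apply contractive_bounded; auto. intros f Hf; destruct (Hth f Hf); split; auto; lra.
Qed.

Definition val (r t : R) : C := ev th (r * cos t, r * sin t).

Let val_bound r t : 0 <= r < 1 -> Cab (val r t) <= 1.
Proof.
  intros Hr; apply Cab_le; [lra|]. rewrite Rmult_1_l. now apply Hbound, polar_disk.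
Qed.

(* Chebyshev's inequality for [1 - |th|^2] on a circle of radius close to [1], where its mean
   [1 - sum |th_n|^2 r^(2n)] is small. The polynomial [Q] replaces [th] up to [eta]. *)
Lemma modulus_cover eps dl : 0 < eps < 1 -> 0 < dl ->
  exists r l, 0 < r < 1 /\ 1 - dl < r /\ wf l /\ total l <= 288 * PI * eps /\
    forall t, 0 <= t <= 2 * PI -> ~ covered l t -> 1 - 4 * eps <= Cnorm2 (val r t).
Proof.
  (* Chebyshev at level eps divides a mean of order eta by eps, so eta = eps^2 leaves a cover of
     length O(eps). *)
  intros He Hdl. set (eta := eps * eps).
  assert (Heta : 0 < eta) by (apply Rmult_lt_0_compat; lra).
  assert (Heta1 : eta < eps).
  { unfold eta; rewrite <- (Rmult_1_r eps) at 3; apply Rmult_lt_compat_l; lra. }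
  destruct (N2_tail_small th (eta / 2) Ht ltac:(lra)) as [N HN].
  (* Makes r so close to 1 that r^n >= 1 - eta/4 for n < N, by Bernoulli's inequality. *)
  set (m := Rmin (Rmin dl 1) (eta / (4 * (INR N + 1)))).
  pose proof (pos_INR N) as HN0.
  assert (Hm : 0 < m /\ m <= dl /\ m <= 1 /\ m * (4 * (INR N + 1)) <= eta).
  { unfold m. assert (0 < eta / (4 * (INR N + 1))) by (apply Rdiv_lt_0_compat; lra).
    pose proof (Rmin_l (Rmin dl 1) (eta / (4 * (INR N + 1)))).
    pose proof (Rmin_r (Rmin dl 1) (eta / (4 * (INR N + 1)))).
    pose proof (Rmin_l dl 1). pose proof (Rmin_r dl 1).
    repeat split; try lra; [repeat apply Rmin_pos; lra|].
    apply Rle_trans with (eta / (4 * (INR N + 1)) * (4 * (INR N + 1))).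
    - apply Rmult_le_compat_r; lra.
    - right; field; lra. }
  set (r := 1 - m / 2). assert (Hr : 0 < r < 1) by (unfold r; lra).
  set (k := / (1 - r ^ 2)). pose proof (poisson_num r Hr) as Hden.
  assert (Hk : 0 < k) by now apply Rinv_0_lt_compat.
  (* Evaluation on the circle of radius r has squared norm k, so this tail puts the polynomial
     within eta of [th] there. *)
  destruct (N2_tail_small th (eta * eta / k) Ht) as [N1 HN1].
  { apply Rdiv_lt_0_compat; auto. now apply Rmult_lt_0_compat. }
  set (N' := max N N1).
  (* Dilation moves the circle of radius r to the unit circle, where [density] lives. *)
  set (b := fun n => Cmul (r ^ n, 0) (th n)).
  assert (Eb : forall t, psum N' b (cis t) = psum N' th (r * cos t, r * sin t)).
  { intros t. generalize N'; intros n0; induction n0 as [|n IH]; auto.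
    cbn [psum]. rewrite IH, Cpow_polar, Cpow_cis. f_equal. unfold b; C_solve. }
  assert (Hclose : forall t, Cnorm2 (Csub (val r t) (psum N' b (cis t))) <= eta * eta).
  { intros t. set (z := (r * cos t, r * sin t)).
    assert (Hz : Cnorm2 z < 1) by (apply polar_disk; lra).
    rewrite Eb. fold z. unfold val; fold z. rewrite <- ev_trunc by auto.
    unfold ev. rewrite <- ip_sub_l by auto using inH2_szego with h2.
    fold (ev (fsub th (trunc N' th)) z). eapply Rle_trans; [apply ev_bound; auto with h2|].
    unfold z; rewrite Cnorm2_polar. fold k. specialize (HN1 N' ltac:(lia)).
    apply Rmult_lt_compat_r with (r := k) in HN1; auto.
    unfold Rdiv in HN1; rewrite Rmult_assoc, Rinv_l in HN1 by lra. lra. }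
  assert (HQ : 1 - eta <= N2 (trunc N' b)).
  { assert (Hrn : forall n, (n < N)%nat -> 1 - eta / 4 <= r ^ n).
    { intros n Hn. destruct (pow_bernoulli r n ltac:(lra)) as [P _].
      apply lt_INR in Hn. assert (INR n * (1 - r) <= (INR N + 1) * m).
      { apply Rmult_le_compat; unfold r; try lra. apply pos_INR. } lra. }
    assert (H1 : (1 - eta / 2) * N2 (trunc N th) <= N2 (trunc N' b)).
    { unfold N2. rewrite <- Series_scal_l. apply Series_le.
      - intros n. split; [apply Rmult_le_pos; [lra|apply Cnorm2_ge0]|].
        destruct (Nat.lt_ge_cases n N) as [L|L].
        + rewrite !trunc_lt by lia. unfold b; rewrite Cnorm2_mul.
          apply Rmult_le_compat_r; [apply Cnorm2_ge0|]. specialize (Hrn n L).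
          unfold Cnorm2; simpl.
          assert ((1 - eta / 4) * (1 - eta / 4) <= r ^ n * r ^ n) by (apply Rmult_le_compat; lra).
          pose proof (pow2_ge_0 eta). lra.
        + rewrite trunc_ge by lia. unfold Cnorm2 at 1; simpl. rewrite !Rmult_0_l, Rplus_0_l, Rmult_0_r.
          apply Cnorm2_ge0.
      - apply inH2_iff; auto with h2. }
    specialize (HN N (le_n N)). rewrite N2_tail, Nt in HN by auto.
    assert ((1 - eta / 2) * (1 - eta / 2) <= (1 - eta / 2) * N2 (trunc N th))
      by (apply Rmult_le_compat_l; lra).
    pose proof (pow2_ge_0 eta). lra. }
  (* Nonnegative because the polynomial is within eta of a function bounded by 1; its mean is at
     most 3 eta + eta^2 <= 4 eta, giving 288 = 18 * 4 * 4. *)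
  set (v := fun t => (1 + eta) ^ 2 - density N' b t).
  destruct (density_primitive N' b) as (G & HG & EG).
  set (Gv := fun t => (1 + eta) ^ 2 * t - G t).
  assert (Hval : forall t, Cnorm2 (val r t) <= 1) by (intros; apply Hbound, polar_disk; lra).
  destruct (maximal_cover v Gv eps) as (l & W & T & H).
  - intros x. unfold v, Gv. apply (@is_derive_minus R_AbsRing R_NormedModule); [|apply HG].
    auto_derive; auto; ring.
  - intros x. apply (continuity_pt_minus (fun _ => (1 + eta) ^ 2) (density N' b)).
    + apply continuity_pt_const; intros ? ?; reflexivity.
    + apply density_continuity.
  - intros t. unfold v, density.
    replace (psum N' b (cis t)) with (Cadd (val r t) (Copp (Csub (val r t) (psum N' b (cis t))))) by ring.
    pose proof (Cnorm2_add_le (val r t) (Copp (Csub (val r t) (psum N' b (cis t)))) eta Heta) as A.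
    rewrite Cnorm2_opp in A.
    specialize (Hclose t). specialize (Hval t).
    assert (Hi : 0 < / eta) by now apply Rinv_0_lt_compat.
    apply Rmult_le_compat_l with (r := 1 + / eta) in Hclose; [|lra].
    apply Rmult_le_compat_l with (r := 1 + eta) in Hval; [|lra].
    replace ((1 + / eta) * (eta * eta)) with (eta * eta + eta) in Hclose by (field; lra). lra.
  - lra.
  - exists r, l. split; auto. split; [unfold r; lra|]. split; auto. split.
    + eapply Rle_trans; [exact T|]. unfold Gv.
      replace (_ - _) with (4 * PI * ((1 + eta) ^ 2) - (G (3 * PI) - G (- PI))) by ring.
      rewrite EG. apply Rmult_le_reg_r with eps; [lra|].
      unfold Rdiv; rewrite Rmult_assoc, Rinv_l, Rmult_1_r by lra.
      replace (288 * PI * eps * eps) with (18 * (4 * PI * (4 * eta))) by (unfold eta; ring).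
      apply Rmult_le_compat_l; [lra|]. rewrite <- Rmult_minus_distr_l.
      pose proof PI_RGT_0. apply Rmult_le_compat_l; [lra|].
      assert (eta * eta <= eta * 1) by (apply Rmult_le_compat_l; lra). lra.
    + intros t Ht' Hn.
      assert (Hvt : v t <= eps).
      { apply (density_le v Gv); auto.
        - intros x. unfold v, Gv. apply (@is_derive_minus R_AbsRing R_NormedModule); [|apply HG].
          auto_derive; auto; ring.
        - intros x. apply (continuity_pt_minus (fun _ => (1 + eta) ^ 2) (density N' b)).
          + apply continuity_pt_const; intros ? ?; reflexivity.
          + apply density_continuity. }
      unfold v, density in Hvt.
      replace (psum N' b (cis t)) with (Cadd (val r t) (Copp (Csub (val r t) (psum N' b (cis t))))) in Hvt by ring.
      pose proof (Cnorm2_add_le (val r t) (Copp (Csub (val r t) (psum N' b (cis t)))) eps (proj1 He)) as A.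
      rewrite Cnorm2_opp in A.
      specialize (Hclose t). specialize (Hval t).
      assert (Hi : 0 < / eps) by (apply Rinv_0_lt_compat; lra).
      apply Rmult_le_compat_l with (r := 1 + / eps) in Hclose; [|lra].
      apply Rmult_le_compat_l with (r := eps) in Hval; [|lra].
      replace ((1 + / eps) * (eta * eta)) with (eta * eta + eps * eta) in Hclose
        by (unfold eta; field; lra).
      assert (eta * eta <= eps * 1) by (apply Rmult_le_compat; lra).
      assert (eps * eta <= eps * 1) by (apply Rmult_le_compat_l; lra).
      assert (0 <= eta * eta) by (apply Rmult_le_pos; lra). lra.
Qed.

Lemma dyadic_truncations :
  exists Nk : nat -> nat, (forall k, (Nk k <= Nk (S k))%nat) /\
    forall k, N2 (fsub th (trunc (Nk k) th)) <= (/ 8) ^ k.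
Proof.
  assert (H : forall k, exists N, forall n, (N <= n)%nat -> N2 (fsub th (trunc n th)) < (/ 8) ^ k).
  { intros k; apply N2_tail_small; auto. apply pow_lt; lra. }
  destruct (choice _ H) as [n0 Hn0].
  (* Running sums of the thresholds are monotone and dominate each of them. *)
  set (Nk := fix F k := match k with O => n0 O | S k' => (F k' + n0 (S k'))%nat end).
  exists Nk; split; [intros k; simpl; lia|].
  intros k; left; apply Hn0. destruct k; simpl; lia.
Qed.

Lemma radial_cauchy (F : R -> C) :
  (forall eps, 0 < eps -> exists d, 0 < d /\ forall r r', 0 < r < 1 -> 0 < r' < 1 ->
     1 - d < r -> 1 - d < r' -> Cab (Csub (F r) (F r')) < eps) ->
  exists L, forall eps, 0 < eps -> exists d, 0 < d /\ forall r, 0 < r < 1 -> 1 - d < r ->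
     Cab (Csub (F r) L) < eps.
Proof.
  intros H. set (rho := fun j : nat => 1 - / (INR j + 2)).
  assert (Hrho : forall j, 0 < rho j < 1).
  { intros j; unfold rho. pose proof (pos_INR j).
    assert (0 < / (INR j + 2)) by (apply Rinv_0_lt_compat; lra).
    assert (/ (INR j + 2) < 1) by (rewrite <- Rinv_1; apply Rinv_lt_contravar; lra). lra. }
  assert (Hnear : forall d, 0 < d -> exists N, forall j, (N <= j)%nat -> 1 - d < rho j).
  { intros d Hd; destruct (archimed_cor1 d Hd) as (N & HN & HN0). exists N; intros j Hj.
    assert (/ (INR j + 2) < / INR N).
    { apply Rinv_lt_contravar; [|apply le_INR in Hj; lra].
      apply lt_0_INR in HN0; pose proof (pos_INR j); apply Rmult_lt_0_compat; lra. }
    unfold rho; lra. }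
  assert (Hco : forall c : C -> R, (forall x y, Rabs (c x - c y) <= Cab (Csub x y)) ->
            exists l, is_lim_seq (fun j => c (F (rho j))) (Finite l)).
  { intros c Hc. apply ex_lim_seq_cauchy_corr. intros eps.
    destruct (H eps (cond_pos eps)) as (d & Hd & HF). destruct (Hnear d Hd) as [N HN].
    exists N; intros n m Hn Hm. eapply Rle_lt_trans; [apply Hc|]. apply HF; auto. }
  destruct (Hco fst) as [a Ha].
  { intros x y; unfold Cab; rewrite <- sqrt_Rsqr_abs. apply sqrt_le_1_alt.
    pose proof (pow2_ge_0 (snd x - snd y)). unfold Rsqr, Cnorm2, Csub, Cadd, Copp; simpl; lra. }
  destruct (Hco snd) as [b Hb].
  { intros x y; unfold Cab; rewrite <- sqrt_Rsqr_abs. apply sqrt_le_1_alt.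
    pose proof (pow2_ge_0 (fst x - fst y)). unfold Rsqr, Cnorm2, Csub, Cadd, Copp; simpl; lra. }
  exists (a, b). intros eps He.
  destruct (H (eps / 2)) as (d & Hd & HF); [lra|]. exists d; split; auto. intros r Hr Hrd.
  destruct (Hnear d Hd) as [N HN].
  apply is_lim_seq_Reals in Ha, Hb.
  destruct (Ha (eps / 4)) as [Na HNa]; [lra|]. destruct (Hb (eps / 4)) as [Nb HNb]; [lra|].
  set (j := max N (max Na Nb)).
  specialize (HNa j ltac:(lia)); specialize (HNb j ltac:(lia)). unfold Rdist in *.
  eapply Rle_lt_trans; [apply (Cab_sub_triangle _ (F (rho j)))|].
  specialize (HF r (rho j) Hr (Hrho j) Hrd (HN j ltac:(lia))).
  assert (Cab (Csub (F (rho j)) (a, b)) <= eps / 2); [|lra].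
  apply Cab_le; [lra|]. apply Rabs_def2 in HNa, HNb.
  unfold Cnorm2, Csub, Cadd, Copp; simpl.
  assert (Hs : forall u e, - e < u < e -> u * u <= e * e).
  { intros u e Hu. replace (u * u) with (Rsqr u) by reflexivity.
    apply Rsqr_le_abs_1 with (y := e). rewrite (Rabs_pos_eq e) by lra. apply Rabs_le; lra. }
  pose proof (Hs (fst (F (rho j)) + - a) (eps / 4) ltac:(lra)).
  pose proof (Hs (snd (F (rho j)) + - b) (eps / 4) ltac:(lra)).
  assert (0 < eps * eps) by (apply Rmult_lt_0_compat; lra). lra.
Qed.

(** Off the limsup of the exceptional intervals the block sums are dominated by 2^-k along the
    entire radius, so the partial sums converge uniformly there and a limit exists. The radii of
    [modulus_cover] tend to 1 and force its modulus up to 1. *)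
Lemma isometric_inner : inner th.
Proof.
  split.
  { exists 1; intros z Hz; exists (ev th z); split; [now apply ps_eval_ev|auto]. }
  destruct dyadic_truncations as (Nk & Hmono & HNk).
  pose proof PI_RGT_0 as HPI.
  set (block := fun k => fsub (trunc (Nk (S k)) th) (trunc (Nk k) th)).
  assert (Eblock : forall k, block k = trunc (Nk (S k)) (fsub th (trunc (Nk k) th))).
  { intros k; apply functional_extensionality; intros j; unfold block, fsub.
    destruct (Nat.lt_ge_cases j (Nk (S k))) as [L|L].
    - now rewrite !(trunc_lt (Nk (S k))) by lia.
    - specialize (Hmono k). rewrite !trunc_ge by lia. ring. }
  assert (Nblock : forall k, N2 (trunc (Nk (S k)) (block k)) <= (/ 8) ^ k).
  { intros k. eapply Rle_trans; [apply N2_trunc_le; rewrite Eblock; auto with h2|].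
    rewrite Eblock. eapply Rle_trans; [apply N2_trunc_le; auto with h2|apply HNk]. }
  assert (Pblock : forall k z, Cnorm2 z < 1 ->
    psum (Nk (S k)) (block k) z = Csub (psum (Nk (S k)) th z) (psum (Nk k) th z)).
  { intros k z Hz. pose proof (inH2_szego z Hz). rewrite <- !ev_trunc by auto.
    unfold ev. rewrite <- ip_sub_l by auto with h2. f_equal.
    change (fsub (trunc (Nk (S k)) th) (trunc (Nk k) th)) with (block k).
    apply functional_extensionality; intros j.
    destruct (Nat.lt_ge_cases j (Nk (S k))) as [L|L]; [now rewrite trunc_lt|].
    rewrite trunc_ge by lia. rewrite Eblock, trunc_ge by lia. reflexivity. }
  assert (H1 : forall k, exists l, wf l /\ total l <= 72 * PI * (/ 2) ^ k /\
    forall t, 0 <= t <= 2 * PI -> ~ covered l t -> forall r, 0 < r < 1 ->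
      Cab (psum (Nk (S k)) (block k) (r * cos t, r * sin t)) <= (/ 2) ^ k).
  { intros k. assert (P2 : 0 < (/ 2) ^ k) by (apply pow_lt; lra).
    destruct (radial_maximal (Nk (S k)) (block k) ((/ 2) ^ k * (/ 2) ^ k)) as (l & W & T & H).
    { now apply Rmult_lt_0_compat. }
    exists l; split; auto. split.
    - eapply Rle_trans; [exact T|]. unfold Rdiv.
      replace (72 * PI * (/ 2) ^ k) with
        (72 * PI * (/ 8) ^ k * / ((/ 2) ^ k * (/ 2) ^ k)).
      + apply Rmult_le_compat_r; [left; apply Rinv_0_lt_compat; now apply Rmult_lt_0_compat|].
        apply Rmult_le_compat_l; [lra|apply Nblock].
      + replace (/ 8) with (/ 2 * / 2 * / 2) by field. rewrite !Rpow_mult_distr. field. lra.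
    - intros t Ht' Hn r Hr. apply Cab_le; [lra|]. now apply H. }
  assert (H2 : forall k, exists rl : R * list (R * R), 0 < fst rl < 1 /\ 1 - (/ 2) ^ k < fst rl /\
    wf (snd rl) /\ total (snd rl) <= 288 * PI * (/ 2) ^ k /\
    forall t, 0 <= t <= 2 * PI -> ~ covered (snd rl) t ->
      1 - 4 * (/ 2) ^ k <= Cnorm2 (val (fst rl) t)).
  { intros k. assert (P2 : 0 < (/ 2) ^ k <= 1).
    { split; [apply pow_lt; lra|]. apply (pow_bernoulli (/ 2) k); lra. }
    (* Halving keeps the parameter below 1 when k = 0. *)
    destruct (modulus_cover ((/ 2) ^ k / 2) ((/ 2) ^ k)) as (r & l & Hr & Hr' & W & T & H); try lra.
    exists (r, l); simpl. repeat split; auto; try lra.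
    - assert (0 <= PI * (/ 2) ^ k) by (apply Rmult_le_pos; lra). lra.
    - intros t Ht' Hn; specialize (H t Ht' Hn); lra. }
  destruct (choice _ H1) as [l1 Hl1]; clear H1. destruct (choice _ H2) as [l2 Hl2]; clear H2.
  set (ls := fun k => l1 k ++ snd (l2 k)).
  exists (fun t => forall K, exists k, (K <= k)%nat /\ covered (ls k) t). split.
  (* 360 = 72 + 288, from the two families of covers. *)
  { apply null_limsup with (c := 360 * PI). intros k; unfold ls.
    destruct (Hl1 k) as (W1 & T1 & _), (Hl2 k) as (_ & _ & W2 & T2 & _).
    split; [apply Forall_app; split; auto|]. rewrite total_app. lra. }
  intros t Ht' HE. apply not_all_ex_not in HE. destruct HE as [K HE].
  assert (HK : forall k, (K <= k)%nat -> ~ covered (l1 k) t /\ ~ covered (snd (l2 k)) t).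
  { intros k Hk; split; intros Hcov; apply HE; exists k; split; auto; unfold ls;
      apply covered_app; auto. }
  clear HE.
  set (P := fun k r => psum (Nk k) th (r * cos t, r * sin t)).
  assert (Hstep : forall k r, (K <= k)%nat -> 0 < r < 1 -> Cab (Csub (P (S k) r) (P k r)) <= (/ 2) ^ k).
  { intros k r Hk Hr; unfold P. rewrite <- Pblock by (apply polar_disk; lra).
    apply Hl1; auto. now apply HK. }
  assert (Hsteps : forall k m r, (K <= k)%nat -> 0 < r < 1 ->
     Cab (Csub (P (k + m)%nat r) (P k r)) <= 2 * (/ 2) ^ k - 2 * (/ 2) ^ (k + m)).
  { intros k m r Hk Hr; induction m as [|m IH].
    - rewrite Nat.add_0_r. replace (Csub (P k r) (P k r)) with C0 by ring.
      apply Cab_le; [lra|]. unfold Cnorm2; simpl; lra.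
    - rewrite Nat.add_succ_r. eapply Rle_trans; [apply (Cab_sub_triangle _ (P (k + m)%nat r))|].
      pose proof (Hstep (k + m)%nat r ltac:(lia) Hr). cbn [pow]. lra. }
  assert (Hval : forall k r, (K <= k)%nat -> 0 < r < 1 -> Cab (Csub (val r t) (P k r)) <= 2 * (/ 2) ^ k).
  { intros k r Hk Hr. apply le_epsilon; intros eps He.
    pose proof (poisson_num r Hr) as Hden.
    (* For fixed r the evaluation is bounded, so far truncations approximate [val r t] while the
       telescoped bound stays below 2 * 2^-k. *)
    destruct (half_pow_small (/ (1 - r ^ 2)) (eps * eps)) as [m Hm]; [now apply Rmult_lt_0_compat|].
    eapply Rle_trans; [apply (Cab_sub_triangle _ (P (k + m)%nat r))|].
    pose proof (Hsteps k m r Hk Hr). pose proof (pow_lt (/ 2) (k + m) ltac:(lra)).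
    assert (Cab (Csub (val r t) (P (k + m)%nat r)) <= eps); [|lra].
    apply Cab_le; [lra|]. set (z := (r * cos t, r * sin t)).
    assert (Hz : Cnorm2 z < 1) by (apply polar_disk; lra). pose proof (inH2_szego z Hz).
    unfold P, val; fold z. rewrite <- ev_trunc by auto. unfold ev. rewrite <- ip_sub_l by auto with h2.
    eapply Rle_trans; [apply ev_bound; auto with h2|]. unfold z; rewrite Cnorm2_polar.
    specialize (Hm (k + m)%nat ltac:(lia)). rewrite Rmult_comm. left.
    eapply Rle_lt_trans; [|exact Hm].
    apply Rmult_le_compat_l; [left; now apply Rinv_0_lt_compat|].
    eapply Rle_trans; [apply HNk|]. apply pow_incr; lra. }
  destruct (radial_cauchy (fun r => val r t)) as [L HL].
  (* Two uniform errors 2 * 2^-k make less than eps/2; the polynomial [P k], Lipschitz along the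
     radius, accounts for two more terms eps/4. *)
  { intros eps He. destruct (half_pow_small 4 (eps / 2) ltac:(lra)) as [k0 Hk0].
    set (k := max K k0). specialize (Hk0 k ltac:(lia)).
    destruct (psum_radial (Nk k) th t) as (B & HB & HPB).
    exists (eps / (4 * (B + 1))). split; [apply Rdiv_lt_0_compat; lra|].
    intros r r' Hr Hr' Hd Hd'.
    assert (HBd : forall x, 1 - eps / (4 * (B + 1)) < x -> x < 1 -> B * (1 - x) <= eps / 4).
    { intros x Hx Hx1. apply Rle_trans with ((B + 1) * (eps / (4 * (B + 1)))).
      - apply Rmult_le_compat; lra.
      - right; field; lra. }
    pose proof (HBd r Hd ltac:(lra)). pose proof (HBd r' Hd' ltac:(lra)).
    pose proof (HPB r ltac:(lra)) as B1. pose proof (HPB r' ltac:(lra)) as B2.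
    fold (P k r) in B1. fold (P k r') in B2.
    pose proof (Hval k r ltac:(lia) Hr). pose proof (Hval k r' ltac:(lia) Hr').
    pose proof (Cab_sub_triangle (val r t) (P k r) (val r' t)).
    pose proof (Cab_sub_triangle (P k r) (psum (Nk k) th (cis t)) (val r' t)).
    pose proof (Cab_sub_triangle (psum (Nk k) th (cis t)) (P k r') (val r' t)).
    rewrite (Cab_sub_sym (val r' t)) in *. rewrite (Cab_sub_sym (P k r')) in B2.
    lra. }
  exists L; split.
  (* [radial_limit] measures the squared modulus; below 1 the square is at most the modulus. *)
  - intros eps He. set (e := Rmin 1 eps).
    assert (Hee : 0 < e /\ e <= 1 /\ e <= eps).
    { unfold e; split; [apply Rmin_pos; lra|split; [apply Rmin_l|apply Rmin_r]]. }
    destruct (HL e) as (d & Hd & HF); [tauto|].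
    exists (Rmin d 1); split; [apply Rmin_pos; lra|]. intros r Hr0 Hrd Hr1.
    pose proof (Rmin_l d 1); pose proof (Rmin_r d 1).
    exists (val r t); split; [apply ps_eval_ev; auto; apply polar_disk; lra|].
    specialize (HF r ltac:(lra) ltac:(lra)). rewrite <- Cab_sqr.
    pose proof (Cab_ge0 (Csub (val r t) L)).
    apply Rle_lt_trans with (Cab (Csub (val r t) L) * 1); [apply Rmult_le_compat_l; lra|lra].
  - assert (HL1 : Cab L <= 1).
    { apply le_epsilon; intros eps He. destruct (HL eps He) as (d & Hd & HF).
      set (r := 1 - Rmin d 1 / 2).
      assert (Hr : 0 < r < 1 /\ 1 - d < r).
      { assert (0 < Rmin d 1) by (apply Rmin_pos; lra).
        pose proof (Rmin_l d 1); pose proof (Rmin_r d 1). unfold r; lra. }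
      specialize (HF r ltac:(lra) ltac:(lra)). pose proof (val_bound r t ltac:(lra)).
      replace L with (Cadd (Csub L (val r t)) (val r t)) by ring.
      rewrite Cab_sub_sym in HF. eapply Rle_trans; [apply Cab_add|]. lra. }
    assert (HL2 : 1 <= Cab L).
    { apply le_epsilon; intros eps He. destruct (HL (eps / 2)) as (d & Hd & HF); [lra|].
      destruct (half_pow_small 1 d Hd) as [k1 Hk1].
      destruct (half_pow_small 4 (eps / 2)) as [k2 Hk2]; [lra|].
      set (k := max K (max k1 k2)). specialize (Hk1 k ltac:(lia)). specialize (Hk2 k ltac:(lia)).
      destruct (Hl2 k) as (Hr & Hrk & _ & _ & Hmod). set (r := fst (l2 k)) in *.
      specialize (Hmod t Ht' (proj2 (HK k ltac:(lia)))).
      specialize (HF r Hr ltac:(lra)). pose proof (val_bound r t ltac:(lra)) as V1.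
      pose proof (Cab_ge0 (val r t)) as V0. rewrite <- Cab_sqr in Hmod.
      assert (Cab (val r t) * Cab (val r t) <= Cab (val r t) * 1) by (apply Rmult_le_compat_l; lra).
      assert (Cab (val r t) <= Cab (Csub (val r t) L) + Cab L).
      { replace (val r t) with (Cadd (Csub (val r t) L) L) at 1 by ring. apply Cab_add. }
      lra. }
    rewrite <- Cab_sqr. replace (Cab L) with 1 by lra. ring.
Qed.
End Inner.

Theorem mainTheorem7 (M : fn -> Prop) (p q : fn) :
  closed_subspace M -> M p -> M q -> unit_vec p -> unit_vec q ->
  (forall f, (M f /\ orth f p) <-> (exists g, M g /\ orth g q /\ f = shift g)) ->
  (exists th, inner th /\ q = cauchy th p) /\
  (forall th, inner th -> q = cauchy th p ->
     (forall f, RanH th f -> Hinf f ->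
        M (cauchy p f) -> orth f one -> orth (cauchy p f) p) ->
     isometric_multiplier p (RanH th) /\
     (forall f, M f <-> exists g, RanH th g /\ f = cauchy p g)).
Proof.
  intros HM Mp Mq Up Uq Hpq.
  pose proof (theta_spec M p q HM Mp Mq Up Uq Hpq) as Ht.
  split.
  - exists (theta p q); split; [|rewrite cauchy_comm; auto].
    eapply isometric_inner, theta_isometric; eauto.
  - intros th _ Hq _.
    (* Cancelling p identifies any series with q = th p with the quotient built from the system. *)
    assert (E : th = theta p q).
    { apply (cauchy_cancel p); [apply (unit_nonzero p Up)|].
      rewrite Ht, Hq. apply cauchy_comm. }
    subst th. split.
    + intros f Rf. destruct (RanH_M M p q HM Mp Mq Up Uq Hpq f Rf) as [Mpf Nf].
      pose proof (cs_H2 M HM _ Mpf) as If. split; auto.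
      intros l Hl. apply has_norm2_N2 in Hl. rewrite <- Hl, <- Nf. now apply N2_has_norm2.
    + intros f; split.
      * intros Mf. destruct (M_RanH M p q HM Mp Mq Up Uq Hpq f Mf) as (h & Rh & Eh & _). eauto.
      * intros (g & Rg & ->). now apply (RanH_M M p q HM Mp Mq Up Uq Hpq).
Qed.
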